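(* Let $\tau$ be any Polish topology on $\mathcal{P}_1(\ell_2)$ lying between WOT and SOT$^*$ (that is, $\mathrm{WOT}\subseteq\tau\subseteq \mathrm{SOT}^*$). Then $\tau$ is similar to WOT and to SOT$^*$ on $\mathcal{P}_1(\ell_2)$. In particular, the topologies WOT, SOT$_*$, SOT and SOT$^*$ are similar on $\mathcal{P}_1(\ell_2)$.
   Context: $\ell_2=\ell_2(\mathbb{Z}_+)$ is the complex sequence space, $\mathbb{Z}_+=\{0,1,2,\dots\}$, with canonical basis $(e_n)_{n\ge 0}$. A vector $x=\sum_n x_n e_n$ is positive ($x\ge 0$) if $x_n\ge 0$ for all $n$; a bounded operator $T$ on $\ell_2$ is positive if $Tx\ge 0$ whenever $x\ge 0$. $\mathcal{P}_1(\ell_2)$ denotes the set of all positive operators $T$ on $\ell_2$ with $\|T\|\le 1$. The operator topologies (restricted to $\mathcal{P}_1(\ell_2)$, on which each is Polish) are: WOT: $T_i\to T$ iff $\langle y,T_ix\rangle\to\langle y,Tx\rangle$ for all $x,y$; SOT: $T_i\to T$ iff $\|T_ix-Tx\|\to 0$ for all $x$; SOT$_*$: $T_i\to T$ iff $\|T_i^*y-T^*y\|\to 0$ for all $y$; SOT$^*$: $T_i\to T$ iff both $T_i\to T$ in SOT and $T_i\to T$ in SOT$_*$. Two topologies on a set $\mathbf{Y}$ are called similar if they have the same dense subsets of $\mathbf{Y}$. *)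

(* Defs.v *)
From HB Require Import structures.
From mathcomp Require Import all_boot all_order all_algebra.
From mathcomp Require Import complex ring.
From mathcomp Require Import all_classical all_reals all_analysis.

Set Implicit Arguments.
Unset Strict Implicit.
Unset Printing Implicit Defensive.

Import Order.TTheory GRing.Theory Num.Theory numFieldNormedType.Exports.
Import ComplexField.Normc.

Local Open Scope classical_set_scope.
Local Open Scope ring_scope.

Section ell2.
Variable R : realType.
Implicit Types (x y : nat -> R[i]) (c : R[i]).

Definition sqmod x : R^nat := fun n => normc (x n) ^+ 2.

Definition square_summable : {pred nat -> R[i]} :=
  mem [set x | cvgn (series (sqmod x))].

Lemma square_summableP x :
  reflect (cvgn (series (sqmod x))) (x \in square_summable).
Proof. by apply: (iffP idP); rewrite inE. Qed.

Lemma sqmod_ge0 x n : 0 <= sqmod x n. Proof. exact: sqr_ge0. Qed.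

Lemma normc_ge0 c : 0 <= normc c.
Proof. by case: c => a b; exact: sqrtr_ge0. Qed.

Lemma normcD_le c d : normc (c + d) <= normc c + normc d.
Proof. by have := ComplexField.lec_normD c d; rewrite /= => /andP[]. Qed.

(* a weighted form of the triangle inequality, used both for the stability
   of square summability and, with t = |y| / |x|, for Minkowski *)
Lemma sqmodD_le x y (t : R) n : 0 < t ->
  sqmod (x + y) n <= (1 + t) * sqmod x n + (1 + t^-1) * sqmod y n.
Proof.
move=> t0; rewrite /sqmod; set a := normc (x n); set b := normc (y n).
have ab : normc ((x + y) n) <= a + b by exact: normcD_le.
apply: (@le_trans _ _ ((a + b) ^+ 2)).
  by rewrite ler_pXn2r// nnegrE ?addr_ge0 ?normc_ge0.
rewrite -subr_ge0.
have -> : (1 + t) * a ^+ 2 + (1 + t^-1) * b ^+ 2 - (a + b) ^+ 2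
    = t * (a - t^-1 * b) ^+ 2.
  have tu : t * t^-1 = 1 by rewrite mulfV// gt_eqF.
  have -> : t * (a - t^-1 * b) ^+ 2
    = t * a ^+ 2 - (t * t^-1) * a * b *+ 2 + (t * t^-1) * t^-1 * b ^+ 2.
    by ring.
  by rewrite tu; ring.
by apply: mulr_ge0; [exact: ltW|exact: sqr_ge0].
Qed.

Lemma seriesZD (u v : R^nat) (a b : R) :
  series (fun n => a * u n + b * v n)
  = (fun n => a * series u n + b * series v n).
Proof.
apply/funext => n; rewrite /series/= big_split/=.
by rewrite -!mulr_sumr.
Qed.

Lemma cvg_seriesZD (u v : R^nat) (a b : R) :
  cvgn (series u) -> cvgn (series v) ->
  series (fun n => a * u n + b * v n) @ \oo
    --> a * limn (series u) + b * limn (series v).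
Proof.
by move=> cu cv; rewrite seriesZD; apply: cvgD; apply: cvgM => //; exact: cvg_cst.
Qed.

Lemma sqmodZ c x : sqmod (c *: x) = fun n => normc c ^+ 2 * sqmod x n.
Proof.
by apply/funext => n; rewrite /sqmod -exprMn -normcM.
Qed.

Lemma square_summable_submod_closed : submod_closed square_summable.
Proof.
split.
  apply/square_summableP.
  have -> : series (sqmod 0) = fun=> 0.
    apply/funext => n; rewrite /series/= big1// => i _.
    by rewrite /sqmod normc0 expr0n.
  exact: is_cvg_cst.
move=> c x y /square_summableP cx /square_summableP cy.
apply/square_summableP.
have czx : cvgn (series (sqmod (c *: x))).
  have := @cvg_seriesZD _ _ (normc c ^+ 2) 0 cx cx.
  have -> : (fun n => normc c ^+ 2 * sqmod x n + 0 * sqmod x n)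
      = sqmod (c *: x).
    by rewrite sqmodZ; apply/funext => n; rewrite mul0r addr0.
  by move=> /cvgP.
apply: (@series_le_cvg _ _
    (fun n => (1 + 1) * sqmod (c *: x) n + (1 + 1^-1) * sqmod y n)).
- by move=> n; exact: sqmod_ge0.
- by move=> n; rewrite addr_ge0// mulr_ge0 ?sqmod_ge0// addr_ge0// invr1.
- by move=> n; exact: sqmodD_le.
- by apply/cvg_ex; eexists; exact: cvg_seriesZD.
Qed.

HB.instance Definition _ := GRing.isSubmodClosed.Build _ _ square_summable
  square_summable_submod_closed.

Record ell2 := Ell2 {
  ell2_seq :> nat -> R[i] ;
  _ : ell2_seq \in square_summable }.

HB.instance Definition _ := [isSub for ell2_seq].
HB.instance Definition _ := [Choice of ell2 by <:].
HB.instance Definition _ := [SubChoice_isSubLmodule of ell2 by <:].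

End ell2.

Section ell2_norm.
Variable R : realType.
Implicit Types (x y : ell2 R) (c : R[i]).

Definition l2norm x : R := Num.sqrt (limn (series (sqmod x))).

Lemma ell2_cvg x : cvgn (series (sqmod x)).
Proof. by apply/square_summableP; case: x. Qed.

Lemma lim_sqmod_ge0 x : 0 <= limn (series (sqmod x)).
Proof.
apply: limr_ge; first exact: ell2_cvg.
by near=> n; rewrite /series/= sumr_ge0// => i _; exact: sqmod_ge0.
Unshelve. all: by end_near. Qed.

Lemma l2norm_ge0 x : 0 <= l2norm x. Proof. exact: sqrtr_ge0. Qed.

Lemma sqr_l2norm x : l2norm x ^+ 2 = limn (series (sqmod x)).
Proof. by rewrite sqr_sqrtr// lim_sqmod_ge0. Qed.

Lemma l2norm_eq0 x : l2norm x = 0 -> x = 0.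
Proof.
move=> x0; apply/val_inj/funext => n /=.
have lim0 : limn (series (sqmod x)) = 0 by rewrite -sqr_l2norm x0 expr0n.
have ndx : nondecreasing_seq (series (sqmod x)).
  by apply: nondecreasing_series => k _ _; exact: sqmod_ge0.
have le0 := nondecreasing_cvgn_le ndx (@ell2_cvg x) n.+1.
have xn0 : normc (x n) ^+ 2 <= 0.
  apply: (@le_trans _ _ (limn (series (sqmod x)))); last by rewrite lim0.
  apply: le_trans le0.
  rewrite /series/= big_nat_recr//= lerDr sumr_ge0// => i _.
  exact: sqmod_ge0.
apply: eq0_normc; apply/eqP; rewrite -sqrf_eq0 eq_le xn0.
exact: sqr_ge0.
Qed.

Lemma l2normD x y : l2norm (x + y) <= l2norm x + l2norm y.
Proof.
have [/l2norm_eq0 ->|x0] := eqVneq (l2norm x) 0.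
  by rewrite add0r lerDr l2norm_ge0.
have [/l2norm_eq0 ->|y0] := eqVneq (l2norm y) 0.
  by rewrite addr0 lerDl l2norm_ge0.
have {x0}xp : 0 < l2norm x by rewrite lt_neqAle eq_sym x0 l2norm_ge0.
have {y0}yp : 0 < l2norm y by rewrite lt_neqAle eq_sym y0 l2norm_ge0.
rewrite -(@ler_pXn2r _ 2)// ?nnegrE ?addr_ge0 ?l2norm_ge0//.
pose t := l2norm y / l2norm x; have t0 : 0 < t by rewrite divr_gt0.
have cv := @cvg_seriesZD R _ _ (1 + t) (1 + t^-1)
  (@ell2_cvg x) (@ell2_cvg y).
rewrite sqr_l2norm.
apply: (@le_trans _ _
  ((1 + t) * limn (series (sqmod x)) + (1 + t^-1) * limn (series (sqmod y)))).
  rewrite -(cvg_lim _ cv)//; apply: ler_lim.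
  - exact: ell2_cvg.
  - by apply/cvg_ex; eexists; exact: cv.
  - by near=> n; rewrite /series/=; apply: ler_sum => i _; exact: sqmodD_le.
rewrite -!sqr_l2norm /t.
suff -> : (1 + l2norm y / l2norm x) * l2norm x ^+ 2
    + (1 + (l2norm y / l2norm x)^-1) * l2norm y ^+ 2
    = (l2norm x + l2norm y) ^+ 2 by [].
by field; rewrite ?gt_eqF.
Unshelve. all: by end_near. Qed.

Lemma l2normZ c x : l2norm (c *: x) = normc c * l2norm x.
Proof.
rewrite /l2norm.
have -> : limn (series (sqmod (c *: x)))
    = normc c ^+ 2 * limn (series (sqmod x)).
  have := @cvg_seriesZD R _ _ (normc c ^+ 2) 0
    (@ell2_cvg x) (@ell2_cvg x).
  have -> : (fun n => normc c ^+ 2 * sqmod x n + 0 * sqmod x n)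
      = sqmod (c *: x).
    by rewrite sqmodZ; apply/funext => n; rewrite mul0r addr0.
  by rewrite mul0r addr0 => /cvg_lim -> //.
by rewrite sqrtrM ?sqr_ge0// sqrtr_sqr ger0_norm// normc_ge0.
Qed.

(* In a normedModType over R[i] the norm takes its values in R[i]. *)
Let norm x : R[i] := (l2norm x)%:C%C.

Let norm_triangle x y : norm (x + y) <= norm x + norm y.
Proof. by rewrite /norm -rmorphD/= lecR l2normD. Qed.

Let normZ c x : norm (c *: x) = `|c| * norm x.
Proof. by rewrite /norm l2normZ rmorphM/=. Qed.

Let norm_eq0 x : norm x = 0 -> x = 0.
Proof. by move=> [] /l2norm_eq0. Qed.

HB.instance Definition _ := Lmodule_isNormed.Build R[i] (ell2 R)
  norm_triangle normZ norm_eq0.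

Lemma ell2_normE x : `|x| = (l2norm x)%:C%C.
Proof. by []. Qed.

(* The scalar product is linear in its first argument; R[i]^o is R[i] seen as
   a normed space over itself, which fixes the topology of the limit. *)
Definition dot x y : R[i] :=
  limn (series (fun n => x n * (y n)^*) : nat -> R[i]^o).

End ell2_norm.

Section operators.
Variable R : realType.
Implicit Types T : ell2 R -> ell2 R.

Definition bounded_op T := exists M : R, forall x, l2norm (T x) <= M * l2norm x.

Definition opnorm T : R := sup [set l2norm (T x) | x in [set x | l2norm x <= 1]].

(* In R[i], 0 <= z means that z is real and nonnegative. *)
Definition positive_vec (x : ell2 R) := forall n, 0 <= x n.

Definition positive_op T := forall x, positive_vec x -> positive_vec (T x).

Definition P1 : set (ell2 R -> ell2 R) :=
  [set T | [/\ linear T, bounded_op T, positive_op T & opnorm T <= 1]].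

(* For T linear and bounded, adjoint T y is the vector representing the bounded
   functional x |-> <T x, y>, which exists and is unique by Riesz; the default
   value 0 of xget is then irrelevant. *)
Definition adjoint T (y : ell2 R) : ell2 R :=
  xget 0 [set z | forall x, dot (T x) y = dot x z].

End operators.

Arguments P1 : clear implicits.

(* A topology on a fixed type Y is an element of Topological Y, the structure
   that turns Y into a topologicalType. *)
Section topologies.
Variable Y : Type.
Implicit Types s t : Topological Y.

Definition opens t : set (set Y) := @open (Topological.Pack t).

Definition dense_for t (D : set Y) := @dense (Topological.Pack t) D.

Definition similar_top s t := forall D : set Y, dense_for s D <-> dense_for t D.

Definition polish (R : realType) t :=
  exists m : Metric R Y, let M : metricType R := Metric.Pack m in
  [/\ opens t = @open M,
      forall F : set_system M, ProperFilter F -> cauchy F ->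
        exists x : M, F --> x &
      exists2 D : set M, countable D & dense D].

End topologies.

Section operator_topologies.
Variable R : realType.

(* {ptws U -> V} carries the topology of pointwise convergence, for the norm
   topology of V; SOT_lower stands for SOT_* and SOT_upper for SOT^*. *)
Definition WOT : Topological (P1 R) := Topological.on (initial_topology
  (fun T : P1 R => (fun yx => dot yx.1 (set_val T yx.2))
     : {ptws ell2 R * ell2 R -> R[i]^o})).

Definition SOT : Topological (P1 R) := Topological.on (initial_topology
  (fun T : P1 R => (set_val T : {ptws ell2 R -> ell2 R}))).

Definition SOT_lower : Topological (P1 R) := Topological.on (initial_topology
  (fun T : P1 R => (adjoint (set_val T) : {ptws ell2 R -> ell2 R}))).

Definition SOT_upper : Topological (P1 R) := Topological.on (initial_topology
  (fun T : P1 R => (set_val T : {ptws ell2 R -> ell2 R},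
                    adjoint (set_val T) : {ptws ell2 R -> ell2 R}))).

End operator_topologies.

(* Main.v *)
Require Import Defs.
From mathcomp Require Import all_boot all_order all_algebra.
From mathcomp Require Import complex ring lra.
From mathcomp Require Import all_classical all_reals all_analysis.

(** Everything reduces to one implication: a WOT-dense set D is dense for the
strong-star topology SOT^*. The topologies lie between these two, and a set
that is dense for a topology is dense for every coarser one.

Call an operator S of P_1 norm attaining if every coordinate j is charged by
some positive vector w (that is, w_j > 0) with |S w| = |w|.

If both S and its adjoint are norm attaining, then every SOT^*-neighbourhood
of S is a WOT-neighbourhood of S (WOT_SOT_upper_continuity). Suppose that
contractions A tend weakly to S. Then A w tends weakly to S w while
|A w| <= |w| = |S w|, so no mass of A w can escape to high coordinates
(tail_of_norm). Positivity turns this into a statement on basis vectors: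
0 <= w_j A e_j <= A w coordinatewise, hence the tails of A e_j are controlled
by those of A w, and A e_j tends to S e_j in norm (norm_attaining_cvg). The same
argument applies to the adjoints. This use of domination is what separates
positive contractions from arbitrary ones, for which the result fails.

Such operators S are SOT^*-dense in P_1 (dense_norm_attaining). Truncate T to
its k x k corner and multiply by a factor q < 1 close to 1. This gives a
nonnegative matrix a, to which one adds a single row and a single column, with
small entries outside the new diagonal position, so as to obtain a nonnegative
matrix s with s u = v and s^T v = u for some strictly positive u and v
(balanced_extension). By the Schur test s is a contraction, and |s u| = |u|.
Acting by s on the first k+1 coordinates and as the identity on the others
gives an operator that is norm attaining together with its adjoint, and that
converges to T as k grows, as do the adjoints (block_op_cvg).

Hence a nonempty SOT^*-open set contains some such S, so it is a
WOT-neighbourhood of S and meets D. *)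

Set Implicit Arguments.
Unset Strict Implicit.
Unset Printing Implicit Defensive.

Import Order.TTheory GRing.Theory Num.Theory numFieldNormedType.Exports.
Import ComplexField.Normc.

Local Open Scope classical_set_scope.
Local Open Scope ring_scope.

(** * Nonnegative matrices with a balanced pair of positive vectors *)

Section balanced_matrices.
Variable R : realType.
Implicit Types (s a : nat -> nat -> R) (u v x : nat -> R).

(** Only the corner of s of size n matters; the sign conditions are imposed on
all indices because this spares range side conditions. *)
Definition balanced n s u v :=
  [/\ forall i j, 0 <= s i j,
      (forall i, 0 < u i) /\ (forall i, 0 < v i),
      forall i, (i < n)%N -> \sum_(j < n) s i j * u j = v i &
      forall j, (j < n)%N -> \sum_(i < n) s i j * v i = u j].

Definition transpose s := fun i j => s j i.

Lemma balanced_transpose n s u v :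
  balanced n s u v -> balanced n (transpose s) v u.
Proof. by move=> [s0 [u0 v0] su sv]; split=> // i j; exact: s0. Qed.

(** Both sides are the bilinear form of s at (v, u). *)
Lemma balanced_norm n s u v : balanced n s u v ->
  \sum_(i < n) v i ^+ 2 = \sum_(j < n) u j ^+ 2.
Proof.
move=> [_ _ su sv].
transitivity (\sum_(i < n) \sum_(j < n) s i j * u j * v i).
  by apply: eq_bigr => i _; rewrite -mulr_suml su.
rewrite exchange_big/=; apply: eq_bigr => j _.
by rewrite expr2 -[X in _ = X * _]sv// mulr_suml; apply: eq_bigr => i _; ring.
Qed.

(** The Schur test. Expand the square of each row sum and apply, to each pair of
columns (j, l), the inequality
2 x_j x_l <= x_j^2 u_l / u_j + x_l^2 u_j / u_l; the two balance equations then
evaluate the resulting triple sum exactly. *)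
Lemma schur_test n s u v x : balanced n s u v ->
  \sum_(i < n) (\sum_(j < n) s i j * x j) ^+ 2 <= \sum_(j < n) x j ^+ 2.
Proof.
move=> [s0 [u0 v0] su sv].
pose f i j l := s i j * s i l * (x j ^+ 2 * (u l / u j)).
have -> : \sum_(j < n) x j ^+ 2 =
    \sum_(i < n) \sum_(j < n) \sum_(l < n) f i j l.
  rewrite exchange_big/=; apply: eq_bigr => j _.
  transitivity (x j ^+ 2 / u j * \sum_(i < n) s i j * v i).
    by rewrite sv// -mulrA mulVf ?mulr1// gt_eqF.
  rewrite mulr_sumr; apply: eq_bigr => i _.
  by rewrite -su// !mulr_sumr; apply: eq_bigr => l _; rewrite /f; ring.
apply: ler_sum => i _.
have -> : (\sum_(j < n) s i j * x j) ^+ 2 =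
    \sum_(j < n) \sum_(l < n) s i j * s i l * (x j * x l).
  rewrite expr2 mulr_suml; apply: eq_bigr => j _.
  by rewrite mulr_sumr; apply: eq_bigr => l _; ring.
rewrite -subr_ge0.
have -> : \sum_(j < n) \sum_(l < n) f i j l =
    \sum_(j < n) \sum_(l < n) (f i j l + f i l j) / 2.
  transitivity ((\sum_(j < n) \sum_(l < n) f i j l +
                 \sum_(j < n) \sum_(l < n) f i l j) / 2); last first.
    rewrite -big_split/= mulr_suml; apply: eq_bigr => j _.
    by rewrite -big_split/= mulr_suml.
  rewrite [X in _ + X]exchange_big/=.
  by field.
rewrite -sumrB; apply: sumr_ge0 => j _; rewrite -sumrB; apply: sumr_ge0 => l _.
have uj := u0 j; have ul := u0 l.
have -> : (f i j l + f i l j) / 2 - s i j * s i l * (x j * x l) =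
    s i j * s i l * ((x j * u l - x l * u j) ^+ 2 / (2 * u j * u l)).
  by rewrite /f; field; rewrite !gt_eqF.
apply: mulr_ge0; first exact: mulr_ge0.
apply: divr_ge0; first exact: sqr_ge0.
by rewrite ltW// !mulr_gt0.
Qed.

(** The number q bounds the square of the norm. *)
Definition strict_contraction k a q := forall x,
  \sum_(i < k) (\sum_(j < k) a i j * x j) ^+ 2 <= q * \sum_(j < k) x j ^+ 2.

(** Iterating (u, v) |-> (a^T v, a u) from the constant pair (1, 1) shrinks the
energy |u|^2 + |v|^2 geometrically, so at some step K all entries are at most
1. The sums U and V of the first K iterates then satisfy
a U = V - 1 + v_K <= V and a^T V = U - 1 + u_K <= U. This is a truncated
Neumann series; stopping it early costs only the equality. *)
Lemma subinvariant_pair k a (q : R) : 0 <= q < 1 -> (forall i j, 0 <= a i j) ->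
  strict_contraction k a q -> strict_contraction k (transpose a) q ->
  exists u v, [/\ (forall i, 0 < u i) /\ (forall i, 0 < v i),
    forall i, (i < k)%N -> \sum_(j < k) a i j * u j <= v i &
    forall j, (j < k)%N -> \sum_(i < k) a i j * v i <= u j].
Proof.
move=> /andP[q0 q1] a0 ca cat.
pose step (p : (nat -> R) * (nat -> R)) : (nat -> R) * (nat -> R) :=
  (fun j => \sum_(i < k) a i j * p.2 i, fun i => \sum_(j < k) a i j * p.1 j).
pose p m := iter m step (fun=> 1, fun=> 1).
pose E m := \sum_(i < k) (p m).1 i ^+ 2 + \sum_(i < k) (p m).2 i ^+ 2.
have p0 m i : 0 <= (p m).1 i /\ 0 <= (p m).2 i.
  elim: m i => [|m IH] i; first by rewrite /=.
  by split; apply: sumr_ge0 => j _; apply: mulr_ge0 => //; have [] := IH j.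
have ES m : E m.+1 <= q * E m.
  rewrite /E mulrDr addrC lerD//; first exact: ca.
  exact: cat.
have Eq m : E m <= q ^+ m * E 0%N.
  elim: m => [|m IH]; first by rewrite expr0 mul1r.
  by rewrite exprS -mulrA (le_trans (ES m))// ler_wpM2l.
have [K EK] : exists K, E K <= 1.
  have : (fun m => q ^+ m * E 0%N) @ \oo --> 0 * E 0%N.
    apply: cvgM; last exact: cvg_cst.
    by apply: cvg_expr; rewrite ger0_norm.
  rewrite mul0r => /cvgr0_norm_le /(_ 1 ltr01) [K _ /(_ K (leqnn K)) /= h].
  by exists K; rewrite (le_trans (Eq K))// (le_trans (ler_norm _)).
have pK i : (i < k)%N -> (p K).1 i <= 1 /\ (p K).2 i <= 1.
  move=> ik; have h (r : R) : 0 <= r -> r ^+ 2 <= 1 -> r <= 1.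
    by move=> r0 r1; rewrite -(@ler_pXn2r _ 2)// ?expr1n// nnegrE.
  have sg (w : nat -> R) : w i ^+ 2 <= \sum_(j < k) w j ^+ 2.
    rewrite (bigD1 (Ordinal ik))//= lerDl sumr_ge0// => j _; exact: sqr_ge0.
  have s0 (w : nat -> R) : 0 <= \sum_(j < k) w j ^+ 2.
    by apply: sumr_ge0 => j _; exact: sqr_ge0.
  split; apply: h; rewrite ?(p0 K i).1 ?(p0 K i).2//.
    by apply: le_trans EK; rewrite (le_trans (sg _))// lerDl.
  by apply: le_trans EK; rewrite (le_trans (sg _))// lerDr.
pose U j := \sum_(m < K) (p m).1 j; pose V j := \sum_(m < K) (p m).2 j.
(* If K = 0 then the initial energy 2k is at most 1, so the matrix is empty. *)
case: (posnP K) => [K0|Kp].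
  have kk0 : k = 0%N.
    case: (posnP k) => // kp; move: EK; rewrite K0 /E /= expr1n.
    rewrite !sumr_const card_ord -mulr2n -mulrnA => h; exfalso; move: h.
    by rewrite lern1 muln2; case: (k) kp.
  by exists (fun=> 1), (fun=> 1); split => // i; rewrite kk0.
have UV0 j : 1 <= U j /\ 1 <= V j.
  rewrite /U /V; case: (K) Kp => // K' _; rewrite !big_ord_recl /=.
  by split; rewrite lerDl; apply: sumr_ge0 => m _; have [] := p0 m.+1 j.
exists U, V; split.
- by split=> j; apply: lt_le_trans ltr01 _; have [] := UV0 j.
- move=> i ik.
  have -> : \sum_(j < k) a i j * U j = \sum_(m < K) (p m.+1).2 i.
    rewrite /U; under eq_bigr => j _ do rewrite mulr_sumr.
    by rewrite exchange_big/=.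
  have : 1 + \sum_(m < K) (p m.+1).2 i = V i + (p K).2 i.
    by rewrite /V -(big_ord_recr K (fun m => (p m).2 i)) big_ord_recl.
  by have := (pK i ik).2; lra.
- move=> j jk.
  have -> : \sum_(i < k) a i j * V i = \sum_(m < K) (p m.+1).1 j.
    rewrite /V; under eq_bigr => i _ do rewrite mulr_sumr.
    by rewrite exchange_big/=.
  have : 1 + \sum_(m < K) (p m.+1).1 j = U j + (p K).1 j.
    by rewrite /U -(big_ord_recr K (fun m => (p m).1 j)) big_ord_recl.
  by have := (pK j jk).1; lra.
Qed.

(** Start from a subinvariant pair (u, v) and let b = v - a u and c = u - a^T v be
its nonnegative defects. The extra column b / L and the extra row c / L' absorb
the defects when u and v are prolonged by L and L'. The last row and column
then balance if and only if the corner entry is X / (L L') with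
X = L^2 - <b, v> = L'^2 - <c, u>. Since X is free, taking it large makes
L and L' large and the new row and column small. *)
Lemma balanced_extension k a (q eps : R) : 0 <= q < 1 -> 0 < eps ->
  (forall i j, 0 <= a i j) ->
  strict_contraction k a q -> strict_contraction k (transpose a) q ->
  exists s u v, [/\ balanced k.+1 s u v,
    forall i j, (i < k)%N -> (j < k)%N -> s i j = a i j &
    forall i, (i < k)%N -> s i k <= eps /\ s k i <= eps].
Proof.
move=> q01 e0 a0 ca cat.
have [u [v [[u0 v0] au av]]] := subinvariant_pair q01 a0 ca cat.
(* The maxima only serve to keep b and c nonnegative outside the corner. *)
pose b i := Num.max 0 (v i - \sum_(j < k) a i j * u j).
pose c j := Num.max 0 (u j - \sum_(i < k) a i j * v i).
have b0 i : 0 <= b i by rewrite le_max lexx.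
have c0 i : 0 <= c i by rewrite le_max lexx.
have bE i : (i < k)%N -> b i = v i - \sum_(j < k) a i j * u j.
  by move=> ik; apply/max_idPr; rewrite subr_ge0 au.
have cE j : (j < k)%N -> c j = u j - \sum_(i < k) a i j * v i.
  by move=> jk; apply/max_idPr; rewrite subr_ge0 av.
pose beta := \sum_(i < k) b i * v i; pose gamma := \sum_(j < k) c j * u j.
have beta0 : 0 <= beta by apply: sumr_ge0 => i _; rewrite mulr_ge0// ltW.
have gamma0 : 0 <= gamma by apply: sumr_ge0 => i _; rewrite mulr_ge0// ltW.
pose M := 1 + \sum_(i < k) b i + \sum_(i < k) c i.
have sb0 : 0 <= \sum_(i < k) b i by exact: sumr_ge0.
have sc0 : 0 <= \sum_(i < k) c i by exact: sumr_ge0.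
pose X := (M / eps) ^+ 2.
have M0 : 0 < M by rewrite /M; lra.
have X0 : 0 < X by rewrite exprn_gt0// divr_gt0.
pose L := Num.sqrt (X + beta); pose L' := Num.sqrt (X + gamma).
have LE : L ^+ 2 = X + beta by rewrite sqr_sqrtr// addr_ge0// ltW.
have LE' : L' ^+ 2 = X + gamma by rewrite sqr_sqrtr// addr_ge0// ltW.
have Lge (r : R) : 0 <= r -> M / eps <= Num.sqrt (X + r).
  move=> r0; have Me0 : 0 <= M / eps by rewrite divr_ge0// ltW.
  rewrite -(@ler_pXn2r _ 2) ?nnegrE ?sqrtr_ge0// sqr_sqrtr.
    by rewrite lerDl.
  by rewrite addr_ge0// ltW.
have L0 : 0 < L by rewrite (lt_le_trans _ (Lge _ beta0))// divr_gt0.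
have L0' : 0 < L' by rewrite (lt_le_trans _ (Lge _ gamma0))// divr_gt0.
have small (w : nat -> R) i l : (forall i, 0 <= w i) -> \sum_(i < k) w i <= M ->
    (i < k)%N -> 0 < l -> M / eps <= l -> w i / l <= eps.
  move=> w0 wM ik l0; rewrite ler_pdivrMr// => Ml.
  rewrite ler_pdivrMr// mulrC; apply: le_trans Ml; apply: le_trans wM.
  by rewrite (bigD1 (Ordinal ik))//= lerDl sumr_ge0.
pose s i j := if (i < k)%N then if (j < k)%N then a i j else b i / L
              else if (j < k)%N then c j / L' else X / (L * L').
pose u' j := if (j < k)%N then u j else L.
pose v' j := if (j < k)%N then v j else L'.
exists s, u', v'; split; last first.
- move=> i ik; rewrite /s ik ltnn; split; apply: small => //.
  + by rewrite /M; lra.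
  + exact: Lge.
  + by rewrite /M; lra.
  + exact: Lge.
- by move=> i j ik jk; rewrite /s ik jk.
split.
- move=> i j; rewrite /s; case: ifP => _; case: ifP => _ //.
  + by rewrite divr_ge0// ltW.
  + by rewrite divr_ge0// ltW.
  + by apply: divr_ge0; rewrite ltW// mulr_gt0.
- by split=> i; rewrite /u' /v'; case: ifP.
- move=> i; rewrite ltnS leq_eqVlt => /predU1P[->|ik].
    rewrite big_ord_recr/= /s /u' /v' ltnn.
    under eq_bigr => j _ do rewrite ltn_ord mulrAC.
    rewrite -mulr_suml -/gamma; apply: (mulIf (lt0r_neq0 L0')).
    by rewrite -expr2 LE'; field; rewrite !gt_eqF.
  rewrite big_ord_recr/= /s /u' /v' ltnn ik.
  under eq_bigr => j _ do rewrite ltn_ord.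
  by rewrite divfK ?gt_eqF// bE//; ring.
- move=> j; rewrite ltnS leq_eqVlt => /predU1P[->|jk].
    rewrite big_ord_recr/= /s /u' /v' ltnn.
    under eq_bigr => i _ do rewrite ltn_ord mulrAC.
    rewrite -mulr_suml -/beta; apply: (mulIf (lt0r_neq0 L0)).
    by rewrite -expr2 LE; field; rewrite !gt_eqF.
  rewrite big_ord_recr/= /s /u' /v' ltnn jk.
  under eq_bigr => i _ do rewrite ltn_ord.
  by rewrite divfK ?gt_eqF// cE//; ring.
Qed.

End balanced_matrices.

(** * Convergence of complex sequences and of square summable vectors *)

Lemma cvg_sumr (K : numFieldType) (V : normedModType K) (T I : Type)
    (F : set_system T) {FF : Filter F} (r : seq I) (f : I -> T -> V) (l : I -> V) :
  (forall i, f i @ F --> l i) ->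
  (fun a => \sum_(i <- r) f i a) @ F --> \sum_(i <- r) l i.
Proof. by move=> fl; apply: cvg_big => //; exact: add_continuous. Qed.

Section complex_convergence.
Variable R : realType.
Implicit Types z : R[i].

Lemma complex_gt0P z : reflect (exists2 r : R, 0 < r & z = r%:C%C) (0 < z).
Proof.
apply: (iffP idP) => [|[r r0 ->]]; last by rewrite ltcR.
case: z => a b; rewrite ltcE /= => /andP[/eqP -> a0]; by exists a.
Qed.

(** Norms over a complex normed space are complex numbers; this brings convergence
back to a real sequence. *)
Lemma cvg_real_norm (V : normedModType R[i]) (nrm : V -> R) (T : Type)
    (F : set_system T) {FF : Filter F} (f : T -> V) (l : V) :
  (forall v, `|v| = (nrm v)%:C%C) ->
  f @ F --> l <-> (fun a => nrm (f a - l)) @ F --> (0 : R).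
Proof.
move=> nE.
have n0 v : 0 <= nrm v by rewrite -lecR -nE normr_ge0.
split=> [/cvgrPdist_lt fl|fl].
  apply/cvgrPdist_lt => e e0; have e0' : 0 < e%:C%C by rewrite ltcR.
  apply: filterS (fl _ e0') => a; rewrite distrC nE ltcR => ltae.
  by rewrite sub0r normrN ger0_norm.
apply/cvgrPdist_lt => e /complex_gt0P[r r0 ->].
move/cvgrPdist_lt : fl => /(_ r r0); apply: filterS => a.
by rewrite sub0r normrN ger0_norm// distrC nE ltcR.
Qed.

Lemma cvg_normcP (T : Type) (F : set_system T) {FF : Filter F}
    (f : T -> R[i]^o) (l : R[i]^o) :
  f @ F --> l <-> (fun a => normc (f a - l)) @ F --> (0 : R).
Proof. exact: (@cvg_real_norm R[i]^o (@normc R)). Qed.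

Lemma normc_Re z : `|complex.Re z| <= normc z.
Proof. by rewrite -lecR; exact: normc_ge_Re. Qed.

Lemma normc_Im z : `|complex.Im z| <= normc z.
Proof.
case: z => a b /=; rewrite -sqrtr_sqr ler_sqrt ?lerDr ?sqr_ge0//.
by rewrite addr_ge0// sqr_ge0.
Qed.

Lemma normc_le z : normc z <= `|complex.Re z| + `|complex.Im z|.
Proof.
case: z => a b /=.
rewrite -(@ler_pXn2r _ 2) ?nnegrE ?sqrtr_ge0 ?addr_ge0//.
rewrite sqr_sqrtr ?addr_ge0 ?sqr_ge0// sqrrD !real_normK ?num_real//.
by rewrite -addrA lerD2l lerDr mulrn_wge0// mulr_ge0.
Qed.

Lemma normc_conj z : normc z^* = normc z.
Proof. by case: z => a b /=; rewrite sqrrN. Qed.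

Lemma normc_real (r : R) : normc r%:C%C = `|r|.
Proof. by rewrite /= expr0n addr0 sqrtr_sqr. Qed.

Lemma conj_real (r : R) : (r%:C%C)^* = r%:C%C.
Proof. exact: conjc_real. Qed.

Lemma normcB z w : normc (z - w) = normc (w - z).
Proof. by rewrite -opprB; exact: (@normcN R (w - z)). Qed.

Lemma normc_sum (I : Type) (r : seq I) (f : I -> R[i]) :
  normc (\sum_(i <- r) f i) <= \sum_(i <- r) normc (f i).
Proof.
elim: r => [|i r IH]; first by rewrite !big_nil normc0.
by rewrite !big_cons (le_trans (normcD_le _ _))// lerD2l.
Qed.

Lemma sqr_normcE z : ((normc z) ^+ 2)%:C%C = z * z^*.
Proof. by rewrite rmorphXn/= -(sqr_normc z). Qed.

Lemma cvg_complex (u : nat -> R[i]) (a b : R) :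
  (@complex.Re R \o u) @ \oo --> a -> (@complex.Im R \o u) @ \oo --> b ->
  (u : nat -> R[i]^o) @ \oo --> (a +i* b : R[i]^o)%C.
Proof.
move=> ua ub; apply/cvg_normcP.
apply: (@squeeze_cvgr _ _ _ _ (fun=> 0)
  (fun n => `|complex.Re (u n) - a| + `|complex.Im (u n) - b|)).
- apply: nearW => n; rewrite normc_ge0/=.
  by case: (u n) => c d /=; exact: (@normc_le ((c - a) +i* (d - b))%C).
- exact: cvg_cst.
- rewrite -[0]addr0; apply: cvgD; rewrite -(normr0 R).
    by apply: cvg_norm; apply/subr_cvg0.
  by apply: cvg_norm; apply/subr_cvg0.
Qed.

(** Absolute convergence, one component at a time. *)
Lemma cvg_complex_series (u : nat -> R[i]) :
  cvgn (series (@normc R \o u)) -> cvgn (series u : nat -> R[i]^o).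
Proof.
move=> cu.
have h (p : R[i] -> R) : (forall z, `|p z| <= normc z) ->
    cvgn (series (p \o u)).
  move=> pn; apply: normed_cvg; apply: series_le_cvg cu => n /=; rewrite ?normc_ge0//.
have cR := h _ normc_Re; have cI := h _ normc_Im.
have sR : @complex.Re R \o series u = series (@complex.Re R \o u).
  by apply/funext => n; rewrite /series/= raddf_sum.
have sI : @complex.Im R \o series u = series (@complex.Im R \o u).
  by apply/funext => n; rewrite /series/= raddf_sum.
apply: cvgP (cvg_complex _ _); first by rewrite sR; exact: cR.
by rewrite sI; exact: cI.
Qed.

End complex_convergence.

Section ell2_coordinates.
Variable R : realType.
Implicit Types (x y z : ell2 R).

Lemma ell2_eqP x y : (forall n, x n = y n) -> x = y.
Proof. by move=> xy; apply/val_inj/funext => n; exact: xy. Qed.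

Lemma ell2_sumE (I : Type) (r : seq I) (f : I -> ell2 R) n :
  (\sum_(i <- r) f i) n = \sum_(i <- r) f i n.
Proof. by elim/big_ind2 : _ => // a b c d <- <-. Qed.

Lemma series_sum (f : R^nat) n : series f n = \sum_(0 <= i < n) f i.
Proof. by []. Qed.

Lemma psum_le x n : series (sqmod x) n <= l2norm x ^+ 2.
Proof.
rewrite sqr_l2norm; apply: nondecreasing_cvgn_le; last exact: ell2_cvg.
by apply: nondecreasing_series => k _ _; exact: sqmod_ge0.
Qed.

Lemma l2norm_le2 x (r : R) :
  (forall n, series (sqmod x) n <= r) -> l2norm x ^+ 2 <= r.
Proof.
move=> h; rewrite sqr_l2norm; apply: limr_le; first exact: ell2_cvg.
exact: nearW.
Qed.

Lemma le_l2norm x (r : R) : 0 <= r ->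
  (forall n, series (sqmod x) n <= r ^+ 2) -> l2norm x <= r.
Proof.
move=> r0 h; rewrite -(@ler_pXn2r _ 2) ?nnegrE ?l2norm_ge0//.
exact: l2norm_le2.
Qed.

Lemma bounded_square_summable (f : nat -> R[i]) (M : R) :
  (forall n, series (sqmod f) n <= M) -> f \in @square_summable R.
Proof.
move=> h; apply/square_summableP/nondecreasing_is_cvgn.
  by apply: nondecreasing_series => k _ _; exact: sqmod_ge0.
by exists M => _ [n _ <-].
Qed.

(** Stated on bare sequences because it is what proves truncations summable. *)
Lemma sqmod_trunc m (f : nat -> R[i]) n :
  series (sqmod (fun i => if (i < m)%N then f i else 0)) n =
  series (sqmod f) (minn m n).
Proof.
rewrite /series/= /minn; case: ltnP => [mn|nm]; last first.
  rewrite !big_mkord; apply: eq_bigr => i _.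
  by rewrite /sqmod (leq_trans (ltn_ord i)).
rewrite (big_cat_nat _ (ltnW mn))//= [X in _ + X]big_nat_cond [X in _ + X]big1 ?addr0.
  by apply: eq_big_nat => i /andP[_ im]; rewrite /sqmod im.
by move=> i /andP[/andP[mi _] _]; rewrite /sqmod ltnNge mi normc0 expr0n.
Qed.

Lemma trunc_subproof m (f : nat -> R[i]) :
  (fun i => if (i < m)%N then f i else 0) \in @square_summable R.
Proof.
apply: (@bounded_square_summable _ (series (sqmod f) m)) => n.
rewrite sqmod_trunc.
have /(_ (minn m n) m (geq_minl _ _)) :=
  @nondecreasing_series _ (sqmod f) predT 0 (fun k _ _ => sqmod_ge0 f k).
by [].
Qed.

Definition trunc m (f : nat -> R[i]) : ell2 R := Ell2 (trunc_subproof m f).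

Lemma truncE m f i : trunc m f i = if (i < m)%N then f i else 0.
Proof. by []. Qed.

Definition evec j : ell2 R := trunc j.+1 (fun i => (i == j)%:R).

Lemma evecE j i : evec j i = (i == j)%:R.
Proof. by rewrite /evec truncE; case: ltnP => // ji; rewrite gtn_eqF. Qed.

Lemma trunc_evec m f : trunc m f = \sum_(j < m) f j *: evec j.
Proof.
apply: ell2_eqP => i; rewrite ell2_sumE truncE.
transitivity (\sum_(j < m) f j * (i == j :> nat)%:R); last first.
  by apply: eq_bigr => j _; rewrite -evecE.
case: ltnP => im.
  rewrite (bigD1 (Ordinal im))//= eqxx mulr1 big1 ?addr0// => j ji.
  by rewrite (_ : (i == j :> nat) = false) ?mulr0//; apply: contraNF ji => /eqP e;
    apply/eqP/val_inj.
by rewrite big1// => j _; rewrite gtn_eqF ?mulr0// (leq_trans (ltn_ord j)).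
Qed.

Lemma l2norm_trunc m f : l2norm (trunc m f) ^+ 2 = series (sqmod f) m.
Proof.
apply/eqP; rewrite eq_le; apply/andP; split.
  apply: l2norm_le2 => n; rewrite sqmod_trunc.
  by apply: (@nondecreasing_series _ (sqmod f) predT 0
    (fun k _ _ => sqmod_ge0 f k)); exact: geq_minl.
by apply: le_trans (psum_le _ m); rewrite sqmod_trunc minnn.
Qed.

Lemma tail_small x (eps : R) : 0 < eps -> exists m, forall M,
  \sum_(m <= i < M) sqmod x i <= eps.
Proof.
move=> e0; have /cvgrPdist_le /(_ _ e0) [m _ h] := @ell2_cvg R x.
exists m => M; have [mM|Mm] := leqP m M; last first.
  by rewrite big_geq ?ltW// ltnW.
have /= := h m (leqnn m); rewrite -sqr_l2norm.
rewrite ger0_norm ?subr_ge0 ?psum_le// => /(le_trans _); apply.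
rewrite lerBrDl; apply: le_trans (psum_le x M).
by rewrite /series/= [leRHS](big_cat_nat _ mM).
Qed.

Lemma trunc_cvg x : (fun m => l2norm (trunc m x - x)) @ \oo --> (0 : R).
Proof.
apply/cvgrPdist_le => e e0.
have [m hm] := tail_small x (exprn_gt0 2 e0).
exists m => // n /= mn; rewrite sub0r normrN ger0_norm ?l2norm_ge0//.
have hd i : (i < n)%N -> sqmod (trunc n x - x) i = 0.
  move=> i_n; rewrite /sqmod; change ((trunc n x - x) i) with (trunc n x i - x i).
  by rewrite truncE i_n subrr normc0 expr0n.
have tl i : sqmod (trunc n x - x) i <= sqmod x i.
  have [/hd ->|ni] := ltnP i n; first exact: sqmod_ge0.
  rewrite /sqmod; change ((trunc n x - x) i) with (trunc n x i - x i).
  by rewrite truncE ltnNge ni sub0r (@normcN R).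
apply: le_l2norm; first exact: ltW.
move=> M; rewrite /series/=.
apply: le_trans (hm M).
have [mM|Mm] := leqP m M; last first.
  rewrite [leRHS]big_geq; last exact: ltnW.
  rewrite big_nat_cond big1// => i /andP[/andP[_ iM] _].
  have im : (i < n)%N by rewrite (ltn_trans iM)// (leq_trans Mm).
  exact: hd.
rewrite (big_cat_nat _ mM)//= [X in X + _]big_nat_cond [X in X + _]big1 ?add0r.
  by apply: ler_sum => i _; exact: tl.
by move=> i /andP[/andP[_ im] _]; apply: hd; exact: leq_trans mn.
Qed.

Lemma l2norm0 : l2norm (0 : ell2 R) = 0.
Proof.
by have := @l2normZ R 0 0; rewrite scale0r normc0 mul0r.
Qed.

Lemma l2normN x : l2norm (- x) = l2norm x.
Proof. by rewrite -scaleN1r l2normZ (@normcN R) normc1 mul1r. Qed.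

Lemma l2normB x y : l2norm (x - y) = l2norm (y - x).
Proof. by rewrite -opprB l2normN. Qed.

Lemma ell2_cvgP (T : Type) (F : set_system T) {FF : Filter F} (f : T -> ell2 R) x :
  f @ F --> x <-> (fun a => l2norm (f a - x)) @ F --> (0 : R).
Proof. exact: cvg_real_norm. Qed.

Lemma cvg_trunc x : (fun m => trunc m x) @ \oo --> x.
Proof. by apply/ell2_cvgP; exact: trunc_cvg. Qed.

(** On finitely many coordinates pointwise convergence is norm convergence, and
uniformly small tails make the remaining coordinates negligible. *)
Lemma ell2_cvg_tail (T : Type) (F : set_system T) {FF : Filter F}
    (f : T -> ell2 R) x :
  (forall i, (fun a => (f a i : R[i]^o)) @ F --> (x i : R[i]^o)) ->
  (forall eps : R, 0 < eps -> exists m, \forall a \near F, forall M,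
    \sum_(m <= i < M) sqmod (f a) i <= eps) ->
  f @ F --> x.
Proof.
move=> fx ft; apply/ell2_cvgP/cvgrPdist_le => e e0.
have e5 : 0 < e ^+ 2 / 5 by rewrite divr_gt0// exprn_gt0.
have [m1 h1] := ft _ e5; have [m2 h2] := tail_small x e5.
pose m := maxn m1 m2.
have tl (y : ell2 R) k M : (k <= m)%N ->
    \sum_(m <= i < M) sqmod y i <= \sum_(k <= i < M) sqmod y i.
  move=> km; have [mM|Mm] := leqP m M.
    by rewrite [leRHS](big_cat_nat km mM)/= lerDr sumr_ge0// => i _; exact: sqmod_ge0.
  by rewrite big_geq 1?ltnW// sumr_ge0// => i _; exact: sqmod_ge0.
have head : (fun a => \sum_(0 <= i < m) sqmod (f a - x) i) @ F --> (0 : R).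
  rewrite [X in _ --> X](_ : _ = \sum_(0 <= i < m) (0 : R)); last by rewrite big1.
  apply: cvg_sumr => i; rewrite -(mul0r (0 : R)).
  have /cvg_normcP h := fx i.
  by apply: cvgM; exact: h.
move/cvgrPdist_le : head => /(_ _ e5) head.
near=> a.
rewrite sub0r normrN ger0_norm ?l2norm_ge0//.
apply: le_l2norm; first exact: ltW.
move=> M; rewrite /series/=.
apply: (@le_trans _ _ (\sum_(0 <= i < m) sqmod (f a - x) i +
    \sum_(m <= i < M) sqmod (f a - x) i)).
  have [mM|Mm] := leqP m M; first by rewrite (big_cat_nat _ mM).
  rewrite [leRHS](_ : _ = \sum_(0 <= i < m) sqmod (f a - x) i); last first.
    by rewrite [X in _ + X]big_geq ?addr0// ltnW.
  rewrite [leRHS](big_cat_nat _ (ltnW Mm))//= lerDl sumr_ge0// => i _.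
  exact: sqmod_ge0.
have H1 : \sum_(0 <= i < m) sqmod (f a - x) i <= e ^+ 2 / 5.
  apply: le_trans (ler_norm _) _; rewrite -normrN -sub0r.
  by near: a; exact: head.
have H2 : \sum_(m <= i < M) sqmod (f a) i <= e ^+ 2 / 5.
  apply: le_trans (tl _ _ _ (leq_maxl _ _)) _.
  by move: M {H1}; near: a.
have H3 : \sum_(m <= i < M) sqmod x i <= e ^+ 2 / 5.
  exact: le_trans (tl _ _ _ (leq_maxr _ _)) (h2 M).
have H4 : \sum_(m <= i < M) sqmod (f a - x) i <=
    2 * \sum_(m <= i < M) sqmod (f a) i + 2 * \sum_(m <= i < M) sqmod x i.
  rewrite !mulr_sumr -big_split/=; apply: ler_sum => i _.
  have := @sqmodD_le R (f a) (- x) 1 i ltr01.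
  rewrite invr1 (_ : 1 + 1 = 2)// (_ : sqmod (- x) i = sqmod x i)//.
  by rewrite /sqmod /= (@normcN R).
lra.
Unshelve. all: by end_near. Qed.

(** If the norm does not increase in the limit, the mass carried by the first m
coordinates already exhausts it, which leaves little for the tails. This is the
mechanism behind the fact that weak convergence together with convergence of
the norms implies norm convergence in a Hilbert space. *)
Lemma tail_of_norm (T : Type) (F : set_system T) {FF : Filter F}
    (f : T -> ell2 R) x :
  (forall i, (fun a => (f a i : R[i]^o)) @ F --> (x i : R[i]^o)) ->
  (forall eps : R, 0 < eps ->
    \forall a \near F, l2norm (f a) ^+ 2 <= l2norm x ^+ 2 + eps) ->
  forall eps : R, 0 < eps -> exists m, \forall a \near F, forall M,
    \sum_(m <= i < M) sqmod (f a) i <= eps.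
Proof.
move=> fx fn e e0; have e3 : 0 < e / 3 by rewrite divr_gt0.
have /cvgrPdist_le /(_ _ e3) [m _ hm] := @ell2_cvg R x.
have {hm} := hm m (leqnn m); rewrite /= -sqr_l2norm => hm.
have head : (fun a => series (sqmod (f a)) m) @ F --> series (sqmod x) m.
  apply: cvg_sumr => i.
  have h : (fun a => normc (f a i)) @ F --> normc (x i).
    have /cvg_normcP h := fx i.
    apply/cvgrPdist_le => d d0.
    move/cvgrPdist_le : h => /(_ _ d0); apply: filterS => a.
    rewrite sub0r normrN ger0_norm ?normc_ge0// => /(le_trans _); apply.
    have n1 := normcD_le (f a i - x i) (x i).
    have n2 := normcD_le (x i - f a i) (f a i).
    move: n1 n2; rewrite !subrK normcB => n1 n2.
    by rewrite ler_norml; apply/andP; split; lra.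
  by apply: cvgM; exact: h.
move/cvgrPdist_le : head => /(_ _ e3) head.
exists m; near=> a => M.
have [mM|Mm] := leqP m M; last by rewrite big_geq ?ltW// ltnW.
have H1 : `|series (sqmod x) m - series (sqmod (f a)) m| <= e / 3.
  by near: a.
have H2 : l2norm (f a) ^+ 2 <= l2norm x ^+ 2 + e / 3 by near: a; exact: fn.
have H3 := psum_le (f a) M.
have H4 : series (sqmod (f a)) M =
    series (sqmod (f a)) m + \sum_(m <= i < M) sqmod (f a) i.
  by rewrite /series/= (big_cat_nat _ mM).
move: H1 hm; rewrite !ler_norml => /andP[? ?] /andP[? ?]; lra.
Unshelve. all: by end_near. Qed.

End ell2_coordinates.

(** * The scalar product and adjoints *)

Section scalar_product.
Variable R : realType.
Implicit Types (x y z : ell2 R) (c : R[i]).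

(** By |x_n y_n| <= |x_n|^2 + |y_n|^2. *)
Lemma dot_cvg x y :
  cvgn (series (fun n => x n * (y n)^*) : nat -> R[i]^o).
Proof.
apply: cvg_complex_series.
have cv := @cvg_seriesZD R _ _ 1 1 (@ell2_cvg R x) (@ell2_cvg R y).
apply: (@series_le_cvg _ _ (fun n => 1 * sqmod x n + 1 * sqmod y n)).
- by move=> n /=; exact: normc_ge0.
- by move=> n; rewrite !mul1r addr_ge0// sqmod_ge0.
- move=> n /=; rewrite normcM normc_conj !mul1r /sqmod.
  have := sqr_ge0 (normc (x n) - normc (y n)).
  have := normc_ge0 (x n); have := normc_ge0 (y n); nra.
- exact: cvgP cv.
Qed.

Lemma dot_lim x y :
  (series (fun n => x n * (y n)^*) : nat -> R[i]^o) @ \oo --> (dot x y : R[i]^o).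
Proof. exact: dot_cvg. Qed.

Lemma dot_unique x y (l : R[i]) :
  (series (fun n => x n * (y n)^*) : nat -> R[i]^o) @ \oo --> (l : R[i]^o) ->
  dot x y = l.
Proof. by move=> h; apply: (cvg_unique _ (@dot_lim x y) h). Qed.

Lemma dotDl x y z : dot (x + y) z = dot x z + dot y z.
Proof.
apply: dot_unique.
have -> : series (fun n => (x + y) n * (z n)^*) =
    series (fun n => x n * (z n)^*) \+ series (fun n => y n * (z n)^*).
  apply/funext => n; rewrite /series/= -big_split/=.
  by apply: eq_bigr => i _; rewrite -mulrDl.
by apply: cvgD; exact: dot_lim.
Qed.

Lemma dotZl c x z : dot (c *: x) z = c * dot x z.
Proof.
apply: dot_unique.
have -> : series (fun n => (c *: x) n * (z n)^*) =
    (fun n => c *: (series (fun n => x n * (z n)^*) n : R[i]^o)).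
  apply/funext => n; rewrite /series/= scaler_sumr.
  by apply: eq_bigr => i _; rewrite -mulrA.
by apply: cvgZr; exact: dot_lim.
Qed.

Lemma dot0l z : dot 0 z = 0.
Proof. by rewrite -(scale0r (0 : ell2 R)) dotZl mul0r. Qed.

Lemma dotBl x y z : dot (x - y) z = dot x z - dot y z.
Proof. by rewrite dotDl -scaleN1r dotZl mulN1r. Qed.

Lemma dot_suml (I : Type) (r : seq I) (f : I -> ell2 R) z :
  dot (\sum_(i <- r) f i) z = \sum_(i <- r) dot (f i) z.
Proof.
elim: r => [|i r IH]; first by rewrite !big_nil dot0l.
by rewrite !big_cons dotDl IH.
Qed.

Lemma conj_cvg (T : Type) (F : set_system T) {FF : Filter F} (f : T -> R[i]^o)
    (l : R[i]^o) :
  f @ F --> l -> (fun a => (f a)^* : R[i]^o) @ F --> (l^* : R[i]^o).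
Proof.
move=> /cvg_normcP fl; apply/cvg_normcP.
by under eq_cvg => a do rewrite -rmorphB normc_conj.
Qed.

Lemma dotC x y : dot y x = (dot x y)^*.
Proof.
apply: dot_unique.
have -> : series (fun n => y n * (x n)^*) =
    (fun n => (series (fun n => x n * (y n)^*) n)^*).
  apply/funext => n; rewrite /series/= rmorph_sum/=.
  by apply: eq_bigr => i _; rewrite rmorphM/= conjCK mulrC.
exact: conj_cvg (@dot_lim x y).
Qed.

Lemma dot_evecr x i : dot x (evec R i) = x i.
Proof.
apply: dot_unique; apply/cvg_normcP/cvgrPdist_le => e e0.
exists i.+1 => // n /= i_n.
have -> : series (fun n => x n * (evec R i n)^*) n = x i.
  change (\sum_(0 <= k < n) x k * (evec R i k)^* = x i).
  rewrite (bigD1_seq i) ?iota_uniq ?mem_index_iota//.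
  rewrite evecE eqxx conjC1 mulr1 big1 => [|j ji]; first exact: addr0.
  by rewrite evecE (negbTE ji) conjC0 mulr0.
by rewrite subrr normc0 subrr normr0 ltW.
Qed.

Lemma dot_evecl i y : dot (evec R i) y = (y i)^*.
Proof. by rewrite dotC dot_evecr. Qed.

(** The weighted inequality 2 |x_n| |y_n| <= t |x_n|^2 + |y_n|^2 / t passes to the
limit; optimising over t yields Cauchy-Schwarz. *)
Lemma dot_bound x y (t : R) : 0 < t ->
  normc (dot x y) <= (t * l2norm x ^+ 2 + t^-1 * l2norm y ^+ 2) / 2.
Proof.
move=> t0; have /cvg_normcP/cvgrPdist_le lim := @dot_lim x y.
apply/ler_addgt0Pr => e e0; have [m _ /(_ m (leqnn m)) /=] := lim _ e0.
rewrite sub0r normrN ger0_norm ?normc_ge0//.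
set s := series _ m => hs.
have h1 : normc (dot x y) <= normc s + e.
  have := normcD_le (dot x y - s) s; rewrite subrK normcB.
  by move: hs; lra.
apply: le_trans h1 _; rewrite lerD2r.
apply: (@le_trans _ _ ((t * series (sqmod x) m + t^-1 * series (sqmod y) m) / 2)).
  rewrite /s /series/= !mulr_sumr -big_split/= mulr_suml.
  apply: le_trans (normc_sum _ _) _; apply: ler_sum => i _.
  rewrite normcM normc_conj /sqmod.
  set a := normc _; set b := normc _.
  rewrite -subr_ge0 (_ : _ - _ = (t * a - b) ^+ 2 / (2 * t)); last first.
    by field; rewrite gt_eqF.
  by rewrite divr_ge0 ?sqr_ge0// mulr_ge0// ltW.
rewrite ler_pM2r ?invr_gt0// lerD// ler_wpM2l ?psum_le//; first exact: ltW.
by rewrite invr_ge0 ltW.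
Qed.

Lemma cauchy_schwarz x y : normc (dot x y) <= l2norm x * l2norm y.
Proof.
have [/l2norm_eq0 ->|x0] := eqVneq (l2norm x) 0.
  by rewrite dot0l normc0 mulr_ge0 ?l2norm_ge0.
have [/l2norm_eq0 ->|y0] := eqVneq (l2norm y) 0.
  by rewrite dotC dot0l conjC0 normc0 mulr_ge0 ?l2norm_ge0.
have {}x0 : 0 < l2norm x by rewrite lt_neqAle eq_sym x0 l2norm_ge0.
have {}y0 : 0 < l2norm y by rewrite lt_neqAle eq_sym y0 l2norm_ge0.
have := @dot_bound x y (l2norm y / l2norm x) (divr_gt0 y0 x0).
rewrite (_ : _ / 2 = l2norm x * l2norm y)//.
by field; rewrite !gt_eqF.
Qed.

Lemma dot_cvgl (T : Type) (F : set_system T) {FF : Filter F} (f : T -> ell2 R)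
    x y : f @ F --> x ->
  (fun a => dot (f a) y : R[i]^o) @ F --> (dot x y : R[i]^o).
Proof.
move=> /ell2_cvgP fx; apply/cvg_normcP.
apply: (@squeeze_cvgr _ _ _ _ (fun=> 0) (fun a => l2norm (f a - x) * l2norm y)).
- by apply: nearW => a; rewrite normc_ge0 -dotBl cauchy_schwarz.
- exact: cvg_cst.
- by rewrite -(mul0r (l2norm y)); apply: cvgM => //; exact: cvg_cst.
Qed.

Lemma dot_cvgr (T : Type) (F : set_system T) {FF : Filter F} (f : T -> ell2 R)
    x y : f @ F --> x ->
  (fun a => dot y (f a) : R[i]^o) @ F --> (dot y x : R[i]^o).
Proof.
move=> fx; rewrite dotC; under eq_cvg => a do rewrite dotC.
by apply: conj_cvg; exact: dot_cvgl.
Qed.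

(** The partial sums are real and nonnegative; the limit is compared with them up
to e, separately in the real and in the imaginary part. *)
Lemma dot_ge0 x y : positive_vec x -> positive_vec y -> 0 <= dot x y.
Proof.
move=> x0 y0.
have s0 n : 0 <= series (fun n => x n * (y n)^*) n.
  by rewrite /series/=; apply: sumr_ge0 => i _; rewrite mulr_ge0// conjC_ge0.
have /cvg_normcP/cvgrPdist_le lim := @dot_lim x y.
have h (e : R) : 0 < e -> `|complex.Im (dot x y)| <= e /\ - e <= complex.Re (dot x y).
  move=> /lim [m _ /(_ m (leqnn m)) /=].
  rewrite sub0r normrN ger0_norm ?normc_ge0//.
  have := s0 m; move: (series _ m) => s; rewrite lecE => /andP[/eqP /= s1 s2].
  rewrite normcB => hs.
  have := le_trans (normc_Re _) hs; have := le_trans (normc_Im _) hs.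
  case: s s1 s2 {hs} => a b /= -> a0; case: (dot x y) => c d /=.
  rewrite subr0 => ->; rewrite ler_norml => /andP[+ _].
  by split => //; lra.
rewrite lecE; apply/andP; split.
  rewrite -normr_le0; apply/ler_addgt0Pr => e e0.
  by rewrite add0r; have [] := h _ e0.
rewrite /= -oppr_le0; apply/ler_addgt0Pr => e e0.
by have [_] := h _ e0; lra.
Qed.

End scalar_product.

Section positive_contractions.
Variable R : realType.
Implicit Types (x y z : ell2 R) (T : ell2 R -> ell2 R).

Lemma P1P T : P1 R T <->
  [/\ linear T, positive_op T & forall x, l2norm (T x) <= l2norm x].
Proof.
split.
  move=> [lT [M bT] pT nT]; split => // x.
  have T0 : T 0 = 0 by have := lT (-1) 0 0; rewrite scaler0 addr0 scaleN1r addNr.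
  have TZ c y : T (c *: y) = c *: T y by have := lT c y 0; rewrite T0 !addr0.
  have [/l2norm_eq0 ->|x0] := eqVneq (l2norm x) 0; first by rewrite T0.
  have {}x0 : 0 < l2norm x by rewrite lt_neqAle eq_sym x0 l2norm_ge0.
  pose y := ((l2norm x)^-1)%:C%C *: x.
  have : l2norm (T y) <= 1.
    apply: le_trans nT; apply: ub_le_sup.
      exists (`|M|) => _ [w w1 <-].
      apply: le_trans (bT w) _; apply: le_trans (ler_norm _) _.
      rewrite normrM ler_piMr//.
      by rewrite ger0_norm ?l2norm_ge0.
    exists y => //=.
    by rewrite l2normZ normc_real ger0_norm ?invr_ge0 ?l2norm_ge0// mulVf// gt_eqF.
  rewrite TZ l2normZ normc_real ger0_norm ?invr_ge0 ?l2norm_ge0//.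
  by rewrite ler_pdivrMl// mulr1.
move=> [lT pT nT]; split => //.
  by exists 1 => x; rewrite mul1r.
apply: ge_sup; first by exists (l2norm (T 0)), 0 => //=; rewrite l2norm0.
by move=> _ [x x1 <-]; exact: le_trans (nT x) x1.
Qed.

Section one_operator.
Variable T : ell2 R -> ell2 R.
Hypothesis PT : P1 R T.

Lemma P1_contraction x : l2norm (T x) <= l2norm x.
Proof. by have [_ _] := (P1P T).1 PT; apply. Qed.

Lemma P1Z c x : T (c *: x) = c *: T x.
Proof.
have [lT _ _] := (P1P T).1 PT.
have T0 : T 0 = 0 by have := lT (-1) 0 0; rewrite scaler0 addr0 scaleN1r addNr.
by have := lT c x 0; rewrite T0 !addr0.
Qed.

Lemma P1D x y : T (x + y) = T x + T y.
Proof.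
by have [lT _ _] := (P1P T).1 PT; have := lT 1 x y; rewrite !scale1r.
Qed.

Lemma P1B x y : T (x - y) = T x - T y.
Proof. by rewrite P1D -scaleN1r P1Z scaleN1r. Qed.

Lemma P1_sum (I : Type) (r : seq I) (f : I -> ell2 R) :
  T (\sum_(i <- r) f i) = \sum_(i <- r) T (f i).
Proof.
elim: r => [|i r IH]; last by rewrite !big_cons P1D IH.
by rewrite !big_nil -[in LHS](scale0r (0 : ell2 R)) P1Z scale0r.
Qed.

Lemma P1_trunc m f : T (trunc m f) = \sum_(j < m) f j *: T (evec R j).
Proof. by rewrite trunc_evec P1_sum; apply: eq_bigr => j _; rewrite P1Z. Qed.

Lemma P1_cvg (I : Type) (F : set_system I) {FF : Filter F} (f : I -> ell2 R) x :
  f @ F --> x -> (fun a => T (f a)) @ F --> T x.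
Proof.
move=> /ell2_cvgP fx; apply/ell2_cvgP.
apply: (@squeeze_cvgr _ _ _ _ (fun=> 0) (fun a => l2norm (f a - x))) => //.
- by apply: nearW => a; rewrite l2norm_ge0 -P1B P1_contraction.
- exact: cvg_cst.
Qed.

(** The candidate for the adjoint, read off from the basis vectors. *)
Let adj y n : R[i] := (dot (T (evec R n)) y)^*.

(** Test the functional x |-> <T x, y> on the truncation z of the candidate: its
value there is |z|^2, which is thus at most |z| |y|. This gives at once the
summability of the candidate and the contraction property of the adjoint. *)
Lemma psum_adj y m : series (sqmod (adj y)) m <= l2norm y ^+ 2.
Proof.
set S := series _ m; pose z := trunc m (adj y).
have Sz : S = l2norm z ^+ 2 by rewrite l2norm_trunc.
have Sd : S%:C%C = dot (T z) y.
  rewrite P1_trunc dot_suml /S /series/= big_mkord rmorph_sum/=.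
  by apply: eq_bigr => j _; rewrite dotZl /sqmod sqr_normcE /adj conjCK.
have S0 : 0 <= S by rewrite Sz sqr_ge0.
have : S <= l2norm z * l2norm y.
  rewrite -[leLHS]ger0_norm// -normc_real Sd.
  apply: le_trans (cauchy_schwarz _ _) _.
  by rewrite ler_wpM2r ?l2norm_ge0// P1_contraction.
rewrite Sz; have [->|z0] := eqVneq (l2norm z) 0.
  by rewrite expr0n/= => _; exact: sqr_ge0.
have {}z0 : 0 < l2norm z by rewrite lt_neqAle eq_sym z0 l2norm_ge0.
rewrite expr2 ler_pM2l// => zy.
by rewrite -expr2 ler_pXn2r// nnegrE l2norm_ge0.
Qed.

(** Riesz representation: by linearity the partial sums of <x, z> are
<T (trunc m x), y>, and these converge since truncations converge. *)
Lemma adjointP x y : dot (T x) y = dot x (adjoint T y).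
Proof.
suff [z hz] : exists z, forall x, dot (T x) y = dot x z.
  have := @xgetPex _ 0 [set z | forall x, dot (T x) y = dot x z].
  by move=> /(_ (ex_intro _ z hz)) /(_ x).
exists (Ell2 (bounded_square_summable (psum_adj y))) => {}x.
apply/esym/dot_unique.
have -> : series (fun n => x n * (adj y n)^*) = (fun m => dot (T (trunc m x)) y).
  apply/funext => m; rewrite P1_trunc dot_suml /series/= big_mkord.
  by apply: eq_bigr => j _; rewrite dotZl /adj conjCK.
exact: dot_cvgl (P1_cvg (@cvg_trunc R x)).
Qed.

Lemma adjointE y n : adjoint T y n = (dot (T (evec R n)) y)^*.
Proof. by rewrite adjointP dot_evecl conjCK. Qed.

Lemma adjoint_evecE i j : adjoint T (evec R i) j = (T (evec R j) i)^*.
Proof. by rewrite adjointE dot_evecr. Qed.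

Lemma adjoint_P1 : P1 R (adjoint T).
Proof.
apply/P1P; split.
- move=> c x y; apply: ell2_eqP => n.
  change ((c *: adjoint T x + adjoint T y) n) with
    (c * adjoint T x n + adjoint T y n).
  by rewrite !adjointE -!dotC dotDl dotZl.
- move=> y y0 n; rewrite adjointE conjC_ge0; apply: dot_ge0 => //.
  have [_ pT _] := (P1P T).1 PT; apply: pT => i; rewrite evecE.
  by case: eqP.
- move=> y; apply: le_l2norm; first exact: l2norm_ge0.
  move=> m; rewrite (_ : sqmod _ = sqmod (adj y)); first exact: psum_adj.
  by apply/funext => n; rewrite /sqmod adjointE.
Qed.

Lemma P1_ge0 j i : 0 <= T (evec R j) i.
Proof.
have [_ pT _] := (P1P T).1 PT; apply: pT => l; rewrite evecE.
by case: eqP.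
Qed.

End one_operator.

End positive_contractions.

(** * Norm-attaining operators are points of continuity *)

Section rigidity.
Variable R : realType.
Implicit Types (x y z w : ell2 R) (S T : ell2 R -> ell2 R).

(** Contractions are equicontinuous, so convergence on the basis vectors, whose
span is dense, suffices. *)
Lemma strong_cvg_evec (I : Type) (F : set_system I) {FF : Filter F}
    (A : I -> ell2 R -> ell2 R) S :
  (forall a, P1 R (A a)) -> P1 R S ->
  (forall j, (fun a => A a (evec R j)) @ F --> S (evec R j)) ->
  forall x, (fun a => A a x) @ F --> S x.
Proof.
move=> PA PS AS x; apply/ell2_cvgP/cvgrPdist_le => e e0.
have e3 : 0 < e / 3 by rewrite divr_gt0.
have /cvgrPdist_le /(_ _ e3) [m _ /(_ m (leqnn m)) /=] := @trunc_cvg R x.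
rewrite sub0r normrN ger0_norm ?l2norm_ge0// => hm.
have : (fun a => A a (trunc m x)) @ F --> S (trunc m x).
  rewrite (P1_trunc PS); under eq_cvg => a do rewrite (P1_trunc (PA a)).
  by apply: cvg_sumr => j; apply: cvgZr; exact: AS.
move=> /ell2_cvgP/cvgrPdist_le /(_ _ e3); apply: filterS => a.
rewrite !sub0r !normrN !ger0_norm ?l2norm_ge0// => h.
have -> : A a x - S x = (A a (trunc m x) - S (trunc m x)) +
    (A a (x - trunc m x) + S (trunc m x - x)).
  by rewrite (P1B (PA a)) (P1B PS); apply: ell2_eqP => n;
    change (A a x n - S x n = A a (trunc m x) n - S (trunc m x) n +
      ((A a x n - A a (trunc m x) n) + (S (trunc m x) n - S x n))); ring.
apply: le_trans (l2normD _ _) _.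
have h1 := l2normD (A a (x - trunc m x)) (S (trunc m x - x)).
have h2 := P1_contraction (PA a) (x - trunc m x).
have h3 := P1_contraction PS (trunc m x - x).
rewrite l2normB in h2; lra.
Qed.

Lemma P1_ext S T : P1 R S -> P1 R T ->
  (forall j, S (evec R j) = T (evec R j)) -> S = T.
Proof.
move=> PS PT ST; apply/funext => x.
have : (fun n : nat => S x) @ \oo --> T x.
  by apply: (@strong_cvg_evec _ _ _ (fun=> S)) => // j; rewrite ST; exact: cvg_cst.
move=> /ell2_cvgP h; apply/eqP; rewrite -subr_eq0; apply/eqP/l2norm_eq0.
exact: (cvg_unique _ (cvg_cst _) h).
Qed.

Definition norm_attaining S := forall j, exists w,
  [/\ positive_vec w, 0 < w j & l2norm (S w) = l2norm w].

Lemma ler_normc (a b : R[i]) : 0 <= a -> a <= b -> normc a <= normc b.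
Proof.
move=> a0 ab; rewrite -lecR.
by change (`|a| <= `|b|); rewrite !ger0_norm// (le_trans a0).
Qed.

(** Weak convergence to a norm-attaining positive contraction is strong. The
tails of A w are small by tail_of_norm, and those of A e_j are dominated by
them. *)
Lemma norm_attaining_cvg (I : Type) (F : set_system I) {FF : Filter F}
    (A : I -> ell2 R -> ell2 R) S :
  (forall a, P1 R (A a)) -> P1 R S -> norm_attaining S ->
  (forall x i, (fun a => A a x i : R[i]^o) @ F --> (S x i : R[i]^o)) ->
  forall x, (fun a => A a x) @ F --> S x.
Proof.
move=> PA PS attS AS; apply: strong_cvg_evec => // j.
have [w [w0 wj Sw]] := attS j.
apply: ell2_cvg_tail => // e e0.
pose r := normc (w j).
have wE : w j = r%:C%C.
  by rewrite -[LHS]ger0_norm//; exact: ltW.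
have r0 : 0 < r by move: wj; rewrite wE ltcR.
have [d d0|m hm] := @tail_of_norm R I F _ (A^~ w) (S w) (AS w) _ (e * r ^+ 2)
    (mulr_gt0 e0 (exprn_gt0 2 r0)).
  apply: nearW => a; rewrite Sw -[leLHS]addr0 lerD ?(ltW d0)//.
  by rewrite ler_pXn2r ?nnegrE ?l2norm_ge0// P1_contraction.
exists m; apply: filterS hm => a hm M.
rewrite -(@ler_pM2r _ (r ^+ 2)) ?exprn_gt0//; apply: le_trans (hm M).
rewrite mulr_suml; apply: ler_sum => i _.
rewrite /sqmod -exprMn -normcM mulrC -[leLHS]/(normc (_ * _) ^+ 2).
rewrite ler_pXn2r ?nnegrE ?normc_ge0//.
(* Removing w_j e_j from w leaves a positive vector, so w_j A e_j <= A w. *)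
have wD : w = w j *: evec R j + (w - w j *: evec R j) by rewrite addrC subrK.
have w'0 : positive_vec (w - w j *: evec R j).
  move=> l; change (0 <= w l - w j * evec R j l); rewrite evecE.
  by have [->|_] := eqVneq l j; rewrite ?mulr1 ?subrr// mulr0 subr0.
have p1 := P1_ge0 (PA a) j i.
have p2 : 0 <= A a (w - w j *: evec R j) i.
  by have [_ pA _] := (P1P (A a)).1 (PA a); exact: pA.
rewrite [in leRHS]wD (P1D (PA a)) (P1Z (PA a)).
change (normc (w j * A a (evec R j) i) <= 
  normc (w j * A a (evec R j) i + A a (w - w j *: evec R j) i)).
by apply: ler_normc; [rewrite mulr_ge0// ltW|rewrite lerDl].
Qed.

End rigidity.

(** * Norm-attaining operators are dense *)

Section block_operators.
Variable R : realType.
Implicit Types (s a : nat -> nat -> R) (u v : nat -> R) (x y z w : ell2 R).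

(** The matrix s on the first n coordinates and the identity on the others. Using
the identity rather than 0 there makes every basis vector e_j with j >= n a
vector at which the norm is attained. *)
Definition block_op n s x : ell2 R :=
  trunc n (fun i => \sum_(j < n) (s i j)%:C%C * x j) + (x - trunc n x).

Lemma block_opE n s x i : block_op n s x i =
  if (i < n)%N then \sum_(j < n) (s i j)%:C%C * x j else x i.
Proof.
rewrite /block_op.
change (trunc n (fun i => \sum_(j < n) (s i j)%:C%C * x j) i +
  (x i - trunc n x i) = if (i < n)%N then \sum_(j < n) (s i j)%:C%C * x j else x i).
by rewrite !truncE; case: ifP; rewrite ?subrr ?addr0// subr0 add0r.
Qed.

Lemma block_op_evec n s j i : block_op n s (evec R j) i =
  (if (i < n)%N && (j < n)%N then s i j else (i == j)%:R)%:C%C.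
Proof.
rewrite block_opE evecE; case: ifP => [i_n|_]; last by case: eqP.
under eq_bigr => l _ do rewrite evecE.
case: ltnP => [jn|nj].
  rewrite (bigD1 (Ordinal jn))//= big1 => [|l lj].
    by rewrite eqxx mulr1 addr0.
  have -> : (l == j :> nat) = false by apply: contraNF lj => /eqP e; apply/eqP/val_inj.
  by rewrite mulr0.
rewrite (@ltn_eqF i j) ?(leq_trans i_n)// big1// => l _.
by rewrite (@ltn_eqF l j) ?(leq_trans (ltn_ord l))// mulr0.
Qed.

Section balanced_block.
Variables (n : nat) (s : nat -> nat -> R) (u v : nat -> R).
Hypothesis suv : balanced n s u v.

Lemma block_op_P1 : P1 R (block_op n s).
Proof.
have [s0 _ _ _] := suv.
apply/P1P; split.
- move=> c x y; apply: ell2_eqP => i.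
  change (block_op n s (c *: x + y) i =
    c * block_op n s x i + block_op n s y i).
  rewrite !block_opE; case: ifP => // _.
  rewrite mulr_sumr -big_split/=; apply: eq_bigr => j _.
  change ((s i j)%:C%C * (c * x j + y j) =
    c * ((s i j)%:C%C * x j) + (s i j)%:C%C * y j); ring.
- move=> x x0 i; rewrite block_opE; case: ifP => // _.
  by apply: sumr_ge0 => j _; rewrite mulr_ge0// ler0c.
- move=> x; apply: le_l2norm; first exact: l2norm_ge0.
  move=> m; apply: (@le_trans _ _ (series (sqmod (block_op n s x)) (maxn m n))).
    apply: (@nondecreasing_series _ _ predT 0
      (fun k _ _ => sqmod_ge0 (block_op n s x) k)); exact: leq_maxl.
  apply: le_trans (psum_le x (maxn m n)).
  rewrite !series_sum !(big_cat_nat (leq0n n) (leq_maxr m n)).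
  apply: lerD; last first.
    apply: ler_sum_nat => i /andP[ni _].
    by rewrite /sqmod block_opE ltnNge ni.
  rewrite !big_mkord.
  apply: le_trans (schur_test (fun j => normc (x j)) suv).
  apply: ler_sum => i _; rewrite /sqmod block_opE ltn_ord.
  rewrite ler_pXn2r ?nnegrE ?normc_ge0//; last first.
    by apply: sumr_ge0 => j _; rewrite mulr_ge0 ?normc_ge0.
  apply: le_trans (normc_sum _ _) _; apply: ler_sum => j _.
  by rewrite normcM normc_real ger0_norm.
Qed.

(** Take w = u on the block, where |s u| = |v| = |u|, and w = e_j outside it. *)
Lemma block_op_norm_attaining : norm_attaining (block_op n s).
Proof.
have [s0 [u0 v0] su sv] := suv; move=> j; have [jn|nj] := ltnP j n.
  exists (trunc n (fun i => (u i)%:C%C)); split.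
  - by move=> i; rewrite truncE; case: ifP => // _; rewrite ler0c ltW.
  - by rewrite truncE jn (ltcR 0).
  have -> : block_op n s (trunc n (fun i => (u i)%:C%C)) =
      trunc n (fun i => (v i)%:C%C).
    apply: ell2_eqP => i; rewrite block_opE !truncE; case: ifP => i_n; last by rewrite i_n.
    rewrite -su// rmorph_sum/=; apply: eq_bigr => l _.
    by rewrite ltn_ord -rmorphM.
  apply/eqP; rewrite -(@eqrXn2 _ 2) ?l2norm_ge0// !l2norm_trunc.
  rewrite /series/= !big_mkord /sqmod.
  under eq_bigr => i _ do rewrite normc_real real_normK ?num_real//.
  under [in eqbRHS]eq_bigr => i _ do rewrite normc_real real_normK ?num_real//.
  by rewrite (balanced_norm suv).
exists (evec R j); split.
- by move=> i; rewrite evecE; case: eqP.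
- by rewrite evecE eqxx ltr01.
- congr l2norm; apply: ell2_eqP => i.
  rewrite block_op_evec evecE [X in _ && X]ltnNge nj andbF.
  by case: eqP.
Qed.

End balanced_block.

Lemma adjoint_block_op n s u v : balanced n s u v ->
  adjoint (block_op n s) = block_op n (transpose s).
Proof.
move=> suv; apply: P1_ext.
- exact/adjoint_P1/(block_op_P1 suv).
- exact: block_op_P1 (balanced_transpose suv).
move=> j; apply: ell2_eqP => i.
rewrite adjoint_evecE; last exact: block_op_P1 suv.
rewrite !block_op_evec andbC [j == i]eq_sym /transpose.
by rewrite conj_real.
Qed.

End block_operators.

Section approximation.
Variable R : realType.
Implicit Types (x y z w : ell2 R) (T : ell2 R -> ell2 R).

Definition entries T i j : R := complex.Re (T (evec R j) i).

Lemma entriesE T i j : P1 R T -> T (evec R j) i = (entries T i j)%:C%C.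
Proof.
move=> /P1_ge0 /(_ j i); rewrite /entries; case: (T _ i) => a b.
by rewrite lecE /= => /andP[/eqP -> _].
Qed.

Lemma entries_ge0 T i j : P1 R T -> 0 <= entries T i j.
Proof. by move=> PT; rewrite -ler0c -entriesE// P1_ge0. Qed.

Lemma entries_adjoint T i j : P1 R T ->
  entries (adjoint T) i j = entries T j i.
Proof.
move=> PT; rewrite {1}/entries adjoint_evecE//.
by rewrite entriesE// conj_real.
Qed.

(** A corner of T inherits the contraction property of T. *)
Lemma P1_strict_contraction T k (q : R) : P1 R T ->
  strict_contraction k (fun i j => q * entries T i j) (q ^+ 2).
Proof.
move=> PT x; pose z := trunc k (fun i => (x i)%:C%C).
have zE : l2norm z ^+ 2 = \sum_(j < k) x j ^+ 2.
  rewrite l2norm_trunc /series/= big_mkord; apply: eq_bigr => i _.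
  by rewrite /sqmod normc_real real_normK ?num_real.
rewrite -zE; apply: (@le_trans _ _ (q ^+ 2 * series (sqmod (T z)) k)); last first.
  rewrite ler_wpM2l ?sqr_ge0//; apply: le_trans (psum_le _ _) _.
  by rewrite ler_pXn2r ?nnegrE ?l2norm_ge0// P1_contraction.
rewrite /series/= big_mkord mulr_sumr; apply: ler_sum => i _; rewrite /sqmod.
have -> : T z i = (\sum_(j < k) entries T i j * x j)%:C%C.
  rewrite P1_trunc// ell2_sumE rmorph_sum/=; apply: eq_bigr => j _.
  change ((x j)%:C%C * T (evec R j) i = (entries T i j * x j)%:C%C).
  by rewrite entriesE// -rmorphM/= mulrC.
rewrite normc_real real_normK ?num_real// -exprMn mulr_sumr.
by under eq_bigr => j _ do rewrite -mulrA.
Qed.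

(** Column j converges entrywise, and the square of its norm exceeds that of the
column of T by at most the square of the single new entry, so that
tail_of_norm applies. *)
Lemma block_op_cvg T (s : nat -> nat -> nat -> R) (q d : nat -> R) : P1 R T ->
  (forall k, P1 R (block_op k.+1 (s k))) ->
  (forall k i j, (i < k)%N -> (j < k)%N -> s k i j = q k * entries T i j) ->
  (forall k i, (i < k)%N -> 0 <= s k k i <= d k) ->
  (forall k, 0 <= q k <= 1) -> q @ \oo --> (1 : R) -> d @ \oo --> (0 : R) ->
  forall x, (fun k => block_op k.+1 (s k) x) @ \oo --> T x.
Proof.
move=> PT PS sE sd q01 q1 d0; apply: strong_cvg_evec => // j.
have coord i : (fun k => block_op k.+1 (s k) (evec R j) i : R[i]^o) @ \oo -->
    (T (evec R j) i : R[i]^o).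
  rewrite entriesE//.
  have : (fun k => q k * entries T i j) @ \oo --> entries T i j.
    by rewrite -[X in _ --> X]mul1r; apply: cvgM => //; exact: cvg_cst.
  move=> /cvgrPdist_le h; apply/cvg_normcP/cvgrPdist_le => e /h.
  move=> [K _ hK]; exists (maxn K (maxn i.+1 j.+1)) => // k km.
  have : (maxn K (maxn i.+1 j.+1) <= k)%N by exact: km.
  rewrite !geq_max => /and3P[Kk ik jk].
  change (`|0 - normc (block_op k.+1 (s k) (evec R j) i - (entries T i j)%:C%C)| <= e).
  have -> : block_op k.+1 (s k) (evec R j) i = (q k * entries T i j)%:C%C.
    by rewrite block_op_evec !ltnS (ltnW ik) (ltnW jk) /= sE.
  by rewrite -rmorphB normc_real sub0r normrN ger0_norm// distrC; exact: hK.
apply: (@ell2_cvg_tail R nat \oo _ (fun k => block_op k.+1 (s k) (evec R j)) _ coord).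
apply: (@tail_of_norm R nat \oo _ (fun k => block_op k.+1 (s k) (evec R j)) _ coord).
move=> e e0.
have /cvgrPdist_le : (fun k => d k ^+ 2) @ \oo --> (0 : R).
  by rewrite -(mul0r (0 : R)); apply: cvgM.
move=> /(_ _ e0) [K _ hK]; exists (maxn K j.+1) => // k km.
have : (maxn K j.+1 <= k)%N by exact: km.
rewrite geq_max => /andP[/hK /= dk jk].
move: dk; rewrite sub0r normrN ger0_norm ?sqr_ge0// => dk.
apply: l2norm_le2 => m.
(* The term e, counted at row k only, accounts for the added row. *)
apply: (@le_trans _ _ (\sum_(0 <= i < m) (sqmod (T (evec R j)) i +
   if i == k then e else 0))).
  rewrite series_sum; apply: ler_sum => i _.
  rewrite /sqmod block_op_evec entriesE// !normc_real !real_normK ?num_real//.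
  rewrite !ltnS (ltnW jk) andbT leq_eqVlt.
  have [->|/negbTE ik] /= := eqVneq i k.
    have /andP[s0 sd'] := sd _ _ jk.
    rewrite -[leLHS]add0r lerD ?sqr_ge0//; apply: le_trans dk.
    by rewrite ler_pXn2r ?nnegrE// (le_trans s0).
  rewrite addr0; case: ltnP => [i_k|ki].
    rewrite sE// exprMn ler_piMl ?sqr_ge0//.
    by have /andP[? ?] := q01 k; rewrite expr_le1.
  rewrite (_ : (i == j) = false) ?expr0n ?sqr_ge0//.
  by rewrite gtn_eqF// (leq_trans jk).
rewrite big_split/= lerD//; first exact: psum_le.
rewrite -big_mkcond/= big_const_seq iter_addr_0.
have : (count (pred1 k) (index_iota 0 m) <= 1)%N.
  by rewrite count_uniq_mem ?iota_uniq// leq_b1.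
rewrite /pred1; case: (count _ _) => [|[|//]] _; last by rewrite mulr1n.
by rewrite mulr0n ltW.
Qed.

(** Extend the corner (1 - d_k) T of size k, with d_k = 1 / (k + 1), to a balanced
matrix whose new entries are at most d_k off the diagonal. Transposition
preserves balance, so the adjoints are handled by the same estimates. *)
Lemma dense_norm_attaining T : P1 R T -> exists S : nat -> ell2 R -> ell2 R,
  [/\ forall k, P1 R (S k),
      forall k, norm_attaining (S k) /\ norm_attaining (adjoint (S k)),
      forall x, (fun k => S k x) @ \oo --> T x &
      forall x, (fun k => adjoint (S k) x) @ \oo --> adjoint T x].
Proof.
move=> PT.
pose d (k : nat) : R := k.+1%:R^-1; pose q k : R := 1 - d k.
have d0 k : 0 < d k by rewrite invr_gt0.
have d1 k : d k <= 1 by rewrite invf_le1// ler1n.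
have q01 k : 0 <= q k ^+ 2 < 1.
  rewrite sqr_ge0/= expr_lt1// ?subr_ge0// ltrBlDr ltrDl//.
have q01' k : 0 <= q k <= 1 by rewrite subr_ge0 d1/= gerBl ltW.
have PT' := adjoint_P1 PT.
have t0 k i j : 0 <= q k * entries T i j.
  by have /andP[q0 _] := q01' k; rewrite mulr_ge0 ?entries_ge0.
have ct k := @P1_strict_contraction T k (q k) PT.
have ct' k : strict_contraction k
    (transpose (fun i j => q k * entries T i j)) (q k ^+ 2).
  have -> : transpose (fun i j => q k * entries T i j) =
      fun i j => q k * entries (adjoint T) i j.
    by apply/funext => i; apply/funext => j; rewrite entries_adjoint.
  exact: P1_strict_contraction.
have ex k := balanced_extension (q01 k) (d0 k) (t0 k) (ct k) (ct' k).
pose s k := projT1 (cid (ex k)).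
have sP k : exists u v, [/\ balanced k.+1 (s k) u v,
    forall i j, (i < k)%N -> (j < k)%N -> s k i j = q k * entries T i j &
    forall i, (i < k)%N -> s k i k <= d k /\ s k k i <= d k].
  exact: (projT2 (cid (ex k))).
have Ps k : P1 R (block_op k.+1 (s k)).
  by have [u [v [/block_op_P1]]] := sP k.
have adjs k : adjoint (block_op k.+1 (s k)) = block_op k.+1 (transpose (s k)).
  by have [u [v [/adjoint_block_op]]] := sP k.
have dlim : d @ \oo --> (0 : R) by exact: cvg_harmonic.
have qlim : q @ \oo --> (1 : R).
  by rewrite -[X in _ --> X]subr0; apply: cvgB => //; exact: cvg_cst.
exists (fun k => block_op k.+1 (s k)); split => //.
- move=> k; have [u [v [suv _ _]]] := sP k; split.
    exact: block_op_norm_attaining suv.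
  rewrite adjs; exact: block_op_norm_attaining (balanced_transpose suv).
- apply: (@block_op_cvg T s q d) => // k.
    by have [u [v [_ + _]]] := sP k.
  move=> i ik; have [u [v [[s0 _ _ _] _ /(_ i ik) [_ ->]]]] := sP k.
  by rewrite s0.
- have Pst k : P1 R (block_op k.+1 (transpose (s k))).
    by rewrite -adjs; exact: adjoint_P1.
  have stE k i j : (i < k)%N -> (j < k)%N ->
      transpose (s k) i j = q k * entries (adjoint T) i j.
    move=> ik jk; have [u [v [_ sE _]]] := sP k.
    by rewrite /transpose sE// entries_adjoint.
  have std k i : (i < k)%N -> 0 <= transpose (s k) k i <= d k.
    move=> ik; have [u [v [[s0 _ _ _] _ /(_ i ik) [sd _]]]] := sP k.
    by rewrite /transpose s0.
  move=> x; rewrite (_ : (fun k => _) =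
    (fun k => block_op k.+1 (transpose (s k)) x)).
    exact: block_op_cvg PT' Pst stE std q01' qlim dlim x.
  by apply/funext => k; rewrite adjs.
Qed.

End approximation.

(** * Comparison of the operator topologies *)

Section initial.

Lemma cvg_initial (Y : choiceType) (Z : topologicalType) (f : Y -> Z)
    (F : set_system Y) {FF : Filter F} (y : Y) :
  f @ F --> f y -> F --> (y : initial_topology f).
Proof.
move=> fF A; rewrite nbhsE => -[_ [[B Bo <-] By] BA].
apply: filterS BA _; apply: fF; exact: open_nbhs_nbhs.
Qed.

Lemma dense_coarser (Y : Type) (s t : Topological Y) (D : set Y) :
  opens s `<=` opens t -> dense_for t D -> dense_for s D.
Proof. by move=> st tD O O0 /st; exact: tD. Qed.

(** An initial topology is coarser than any topology making the map continuous. *)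
Lemma opens_initial (Y : choiceType) (Z : topologicalType) (f : Y -> Z)
    (t : Topological Y) :
  (forall y : Y, f @ (@nbhs _ (Topological.Pack t) y) --> f y) ->
  opens (Topological.on (initial_topology f)) `<=` opens t.
Proof.
move=> ft O; rewrite /opens.
rewrite (@openE (initial_topology f)) (@openE (Topological.Pack t)) => hO y Oy.
rewrite /interior/=.
have FF : Filter (@nbhs _ (Topological.Pack t) y).
  exact: (@nbhs_filter (Topological.Pack t) y).
by apply: (cvg_initial (ft y)); exact: hO.
Qed.

End initial.

Lemma cvg_ptws (U : topologicalType) (V : uniformType) (I : Type)
    (F : set_system I) {FF : Filter F} (g : I -> {ptws U -> V})
    (l : {ptws U -> V}) :
  g @ F --> l <-> forall x, (fun a => g a x) @ F --> l x.
Proof. exact: (@pointwise_cvgP U V (g @ F)). Qed.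

Section comparison.
Variable R : realType.
Implicit Types (T : P1 R).

Let ops := {ptws ell2 R -> ell2 R}.

Lemma SOT_upper_cvg (F : set_system (P1 R)) {FF : Filter F} T :
  (forall x, (fun U : P1 R => set_val U x) @ F --> set_val T x) ->
  (forall x, (fun U : P1 R => adjoint (set_val U) x) @ F --> adjoint (set_val T) x) ->
  F --> (T : Topological.Pack (SOT_upper R)).
Proof.
move=> /(@cvg_ptws _ _ _ F FF (fun U : P1 R => set_val U : ops)) h1.
move=> /(@cvg_ptws _ _ _ F FF (fun U : P1 R => adjoint (set_val U) : ops)) h2.
apply: (@cvg_initial _ _ _ F FF T).
exact: cvg_pair h1 h2.
Qed.

Lemma SOT_evaluation_cvg T x :
  (fun U : P1 R => set_val U x) @ (@nbhs _ (Topological.Pack (SOT R)) T)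
    --> set_val T x.
Proof.
have := @initial_continuous _ _ (fun T : P1 R => set_val T : ops) T.
by move=> /(@cvg_ptws _ _ _ _ _ _ _).1 /(_ x).
Qed.

Lemma SOT_lower_evaluation_cvg T x :
  (fun U : P1 R => adjoint (set_val U) x) @
    (@nbhs _ (Topological.Pack (SOT_lower R)) T) --> adjoint (set_val T) x.
Proof.
have := @initial_continuous _ _ (fun T : P1 R => adjoint (set_val T) : ops) T.
by move=> /(@cvg_ptws _ _ _ _ _ _ _).1 /(_ x).
Qed.

Lemma WOT_evaluation_cvg T x y :
  (fun U : P1 R => dot y (set_val U x) : R[i]^o) @
    (@nbhs _ (Topological.Pack (WOT R)) T) --> (dot y (set_val T x) : R[i]^o).
Proof.
have := @initial_continuous _ _ (fun T : P1 R => (fun yx => dot yx.1 (set_val T yx.2))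
     : {ptws ell2 R * ell2 R -> R[i]^o}) T.
by move=> /(@cvg_ptws _ _ _ _ _ _ _).1 /(_ (y, x)).
Qed.

Lemma P1_set_val T : P1 R (set_val T).
Proof. exact: set_valP. Qed.

Lemma WOT_sub_SOT : opens (WOT R) `<=` opens (SOT R).
Proof.
apply: opens_initial => T; apply/cvg_ptws => -[y x] /=.
by apply: dot_cvgr; exact: SOT_evaluation_cvg.
Qed.

Lemma WOT_sub_SOT_lower : opens (WOT R) `<=` opens (SOT_lower R).
Proof.
apply: opens_initial => T; apply/cvg_ptws => -[y x] /=.
rewrite dotC (adjointP (P1_set_val T)).
under eq_cvg => U do rewrite dotC (adjointP (P1_set_val U)).
by apply: conj_cvg; apply: dot_cvgr; exact: SOT_lower_evaluation_cvg.
Qed.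

Lemma SOT_sub_SOT_upper : opens (SOT R) `<=` opens (SOT_upper R).
Proof.
apply: opens_initial => T.
have := @initial_continuous _ _ (fun T : P1 R =>
  (set_val T : ops, adjoint (set_val T) : ops)) T.
move=> h; exact: (@cvg_comp _ _ _ (fun T : P1 R =>
  (set_val T : ops, adjoint (set_val T) : ops)) fst _ _ _ h cvg_fst).
Qed.

Lemma SOT_lower_sub_SOT_upper : opens (SOT_lower R) `<=` opens (SOT_upper R).
Proof.
apply: opens_initial => T.
have := @initial_continuous _ _ (fun T : P1 R =>
  (set_val T : ops, adjoint (set_val T) : ops)) T.
move=> h; exact: (@cvg_comp _ _ _ (fun T : P1 R =>
  (set_val T : ops, adjoint (set_val T) : ops)) snd _ _ _ h cvg_snd).
Qed.

(** A matrix entry of the adjoint is a weakly continuous functional of the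
operator, so the weak topology sees T and its adjoint alike. *)
Lemma WOT_SOT_upper_continuity T :
  norm_attaining (set_val T) -> norm_attaining (adjoint (set_val T)) ->
  @nbhs _ (Topological.Pack (WOT R)) T --> (T : Topological.Pack (SOT_upper R)).
Proof.
move=> attT attT'; have FF := @nbhs_filter (Topological.Pack (WOT R)) T.
have coord (x : ell2 R) i : (fun U : P1 R => set_val U x i : R[i]^o) @
    (@nbhs _ (Topological.Pack (WOT R)) T) --> (set_val T x i : R[i]^o).
  have := @WOT_evaluation_cvg T x (evec R i).
  by move=> /conj_cvg; rewrite dot_evecl conjCK;
    under eq_cvg => U do rewrite dot_evecl conjCK.
have coord' (y : ell2 R) i : (fun U : P1 R => adjoint (set_val U) y i : R[i]^o) @
    (@nbhs _ (Topological.Pack (WOT R)) T) -->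
    (adjoint (set_val T) y i : R[i]^o).
  rewrite (adjointE (P1_set_val T)) -dotC.
  under eq_cvg => U do rewrite (adjointE (P1_set_val U)) -dotC.
  exact: WOT_evaluation_cvg.
have PU := P1_set_val; have PU' U := adjoint_P1 (P1_set_val U).
apply: SOT_upper_cvg.
  exact: (norm_attaining_cvg PU (PU T) attT coord).
exact: (norm_attaining_cvg PU' (PU' T) attT' coord').
Qed.

(** A nonempty strong-star open set contains a point at which the two
neighbourhood filters agree, and is thus a weak neighbourhood of that point. *)
Lemma WOT_dense_SOT_upper (D : set (P1 R)) :
  dense_for (WOT R) D -> dense_for (SOT_upper R) D.
Proof.
move=> dD O [T OT] openO.
have [S [PS attS ST ST']] := dense_norm_attaining (P1_set_val T).
pose S' k : P1 R := exist _ (S k) (mem_set (PS k)).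
have S'T : S' @ \oo --> (T : Topological.Pack (SOT_upper R)).
  by apply: SOT_upper_cvg; [exact: ST|exact: ST'].
have nT : @nbhs _ (Topological.Pack (SOT_upper R)) T O.
  exact: (@open_nbhs_nbhs (Topological.Pack (SOT_upper R))).
have [k _ /(_ k (leqnn k)) OSk] := S'T _ nT.
have [attk attk'] := attS k.
have nSk : @nbhs _ (Topological.Pack (SOT_upper R)) (S' k) O.
  exact: (@open_nbhs_nbhs (Topological.Pack (SOT_upper R))).
have := @WOT_SOT_upper_continuity (S' k) attk attk' _ nSk.
rewrite nbhsE => -[V [Vo Vk] VO].
have [U [VU DU]] := dD V (ex_intro _ _ Vk) Vo.
by exists U; split => //; exact: VO.
Qed.

End comparison.

Theorem theorem1p5 (R : realType) :
  (forall tau : Topological (P1 R),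
     polish R tau ->
     opens (WOT R) `<=` opens tau ->
     opens tau `<=` opens (SOT_upper R) ->
     similar_top tau (WOT R) /\ similar_top tau (SOT_upper R)) /\
  ([/\ similar_top (WOT R) (SOT_lower R),
       similar_top (WOT R) (SOT R) &
       similar_top (WOT R) (SOT_upper R)] /\
   [/\ similar_top (SOT_lower R) (SOT R),
       similar_top (SOT_lower R) (SOT_upper R) &
       similar_top (SOT R) (SOT_upper R)]).
Proof.
have between (tau : Topological (P1 R)) : opens (WOT R) `<=` opens tau ->
    opens tau `<=` opens (SOT_upper R) -> similar_top tau (WOT R).
  move=> wt tu D; split; first exact: dense_coarser.
  by move=> /WOT_dense_SOT_upper; exact: dense_coarser.
have symm (s t : Topological (P1 R)) : similar_top s t -> similar_top t s.
  by move=> st D; split=> /st.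
have trans (s t : Topological (P1 R)) :
    similar_top s (WOT R) -> similar_top t (WOT R) -> similar_top s t.
  by move=> sw tw D; split=> [/sw/tw|/tw/sw].
have upper : similar_top (SOT_upper R) (WOT R).
  apply: between => //; apply: subset_trans (@SOT_sub_SOT_upper R).
  exact: WOT_sub_SOT.
have sot := between _ (@WOT_sub_SOT R) (@SOT_sub_SOT_upper R).
have lower := between _ (@WOT_sub_SOT_lower R) (@SOT_lower_sub_SOT_upper R).
split=> [tau _ wt tu|].
  by have tw := between _ wt tu; split => //; exact: trans.
by split; split; auto.
Qed.
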